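(* Let $N\geq3$, let $\Theta$ be a possibly unbounded smooth open subset of $\mathbb{R}^N$, let $f:\mathbb{R}\to\mathbb{R}$ be a continuous function, and let $F(w):=\int_0^wf(t)\,\mathrm{d}t$ for $w\in\mathbb{R}$. Let $u\in\mathcal{C}^1(\mathbb{R}^N)\cap\mathcal{C}^2(\Theta)\cap\mathcal{C}^2(\mathbb{R}^N\smallsetminus\overline{\Theta})\cap D^{1,2}(\mathbb{R}^N)$ be a solution to the equation $$-\Delta u=Q_\Theta(x)f(u)$$ such that $F(u)\in L^1(\mathbb{R}^N)$. Then $$\frac1{2^*}\int_{\mathbb{R}^N}|\nabla u|^2-\int_{\mathbb{R}^N}Q_\Theta(x)F(u)\,\mathrm{d}x+\frac2N\int_{\partial\Theta}F(u)\,\zeta\cdot\nu_\Theta\,\mathrm{d}\zeta=0,$$ where $\nu_\Theta$ denotes the exterior unit normal to $\Theta$.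
   Context: $2^*:=\frac{2N}{N-2}$. $D^{1,2}(\mathbb{R}^N)=\{u\in L^{2^*}(\mathbb{R}^N):\nabla u\in L^2(\mathbb{R}^N;\mathbb{R}^N)\}$. $Q_\Theta(x):=1$ if $x\in\Theta$ and $Q_\Theta(x):=-1$ if $x\in\mathbb{R}^N\smallsetminus\Theta$. In the boundary integral, $\zeta\in\partial\Theta$ is the integration variable (position vector) and $\mathrm{d}\zeta$ is surface measure.
   Formalization: The integral over the boundary of Θ need not converge absolutely under the stated hypotheses; it is read as the limit of integrals against dilated compactly supported C¹ cutoffs equal to 1 near the origin, and equals the Lebesgue integral whenever the integrand is integrable. *)

(* Defs.v *)
From HB Require Import structures.
From mathcomp Require Import all_boot all_order all_algebra.
From mathcomp Require Import all_classical all_reals all_analysis.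

Set Implicit Arguments.
Unset Strict Implicit.
Unset Printing Implicit Defensive.
Import Order.TTheory GRing.Theory Num.Theory.
Import numFieldNormedType.Exports.
Local Open Scope classical_set_scope.
Local Open Scope ring_scope.

(* R^n is 'rV[R]_n, with the product (equivalently, Borel) sigma-algebra. *)
Definition rV_display : measure_display -> measure_display.
Proof. exact. Qed.

Section measurable_rV.
Context {R : realType} (n : nat).

Let coord_rV (i : 'I_n) (x : 'rV[R]_n) : measurableTypeR R := x ord0 i.

Let rV_set0 : g_sigma_preimage coord_rV set0.
Proof. exact: sigma_algebra0. Qed.

Let rV_setC A : g_sigma_preimage coord_rV A -> g_sigma_preimage coord_rV (~` A).
Proof. exact: sigma_algebraC. Qed.

Let rV_bigcup (F : _^nat) : (forall i, g_sigma_preimage coord_rV (F i)) ->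
  g_sigma_preimage coord_rV (\bigcup_i (F i)).
Proof. exact: sigma_algebra_bigcup. Qed.

HB.instance Definition _ := @isMeasurable.Build (rV_display default_measure_display)
  'rV[R]_n (g_sigma_preimage coord_rV) rV_set0 rV_setC rV_bigcup.

Lemma measurable_coord_rV (i : 'I_n) :
  measurable_fun [set: 'rV[R]_n] (fun x => x ord0 i : measurableTypeR R).
Proof.
move=> _ Y mY; rewrite setTI; apply: sub_sigma_algebra => /=.
rewrite -bigcup_seq/=; exists i => /=; first by rewrite mem_index_enum.
by exists Y => //; rewrite setTI.
Qed.

Lemma measurable_fun_rV d (T : measurableType d) (f : T -> 'rV[R]_n) :
  (forall i, measurable_fun [set: T] (fun x => f x ord0 i : measurableTypeR R)) ->
  measurable_fun [set: T] f.
Proof.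
move=> mf _ A mA; rewrite setTI.
suff: g_sigma_preimage coord_rV `<=` image_set_system setT f measurable.
  by move=> /(_ _ mA); rewrite /image_set_system /= setTI.
apply: smallest_sub; first exact/sigma_algebra_image/sigma_algebra_measurable.
rewrite -bigcup_seq; apply: bigcup_sub => i _ B [C mC <-].
rewrite /image_set_system /= !setTI.
by have := mf i measurableT C mC; rewrite setTI.
Qed.

End measurable_rV.

Section lebesgue_rV.
Context {R : realType}.

Definition rV_cons n (p : measurableTypeR R * 'rV[R]_n) : 'rV[R]_n.+1 :=
  \row_i oapp (fun j => p.2 ord0 j) p.1 (unlift ord0 i).

Definition rV_uncons n (x : 'rV[R]_n.+1) : measurableTypeR R * 'rV[R]_n :=
  (x ord0 ord0, \row_j x ord0 (lift ord0 j)).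

Lemma rV_consK n : cancel (@rV_cons n) (@rV_uncons n).
Proof.
move=> [t y]; rewrite /rV_cons /rV_uncons; congr pair.
  by rewrite mxE unlift_none.
by apply/rowP => j; rewrite !mxE liftK.
Qed.

Lemma measurable_rV_cons n : measurable_fun [set: _] (@rV_cons n).
Proof.
apply: measurable_fun_rV => i; rewrite /rV_cons.
under eq_fun do rewrite mxE.
case: (unlift ord0 i) => [j|] /=; last exact: measurable_fst.
exact: (measurableT_comp (measurable_coord_rV j) measurable_snd).
Qed.

Lemma measurable_rV_uncons n : measurable_fun [set: _] (@rV_uncons n).
Proof.
apply/measurable_fun_pairP; split; first exact: measurable_coord_rV.
apply: measurable_fun_rV => i; rewrite /comp /=.
under eq_fun do rewrite mxE.
exact: measurable_coord_rV.
Qed.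

Section lebesgue_rV_step.
Context (n : nat) (mu : {sigma_finite_measure set 'rV[R]_n -> \bar R}).

Definition lebesgue_rVS : set 'rV[R]_n.+1 -> \bar R :=
  pushforward (@lebesgue_measure R \x mu)%E (@rV_cons n).

Let mpre (A : set 'rV[R]_n.+1) : measurable A -> measurable (@rV_cons n @^-1` A).
Proof. by move=> mA; rewrite -[X in measurable X]setTI; exact: measurable_rV_cons. Qed.

Let lebesgue_rVS0 : lebesgue_rVS set0 = 0%E.
Proof. by rewrite /lebesgue_rVS /pushforward preimage_set0 measure0. Qed.

Let lebesgue_rVS_ge0 A : (0 <= lebesgue_rVS A)%E.
Proof. by rewrite /lebesgue_rVS /pushforward; exact: measure_ge0. Qed.

Let lebesgue_rVS_sigma_additive : semi_sigma_additive lebesgue_rVS.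
Proof.
move=> F mF tF mUF; rewrite /lebesgue_rVS /pushforward preimage_bigcup.
apply: measure_semi_sigma_additive.
- by move=> k; exact: mpre.
- apply/trivIsetP => /= i j _ _ ij; rewrite -preimage_setI.
  by move/trivIsetP : tF => /(_ _ _ _ _ ij) ->//; rewrite preimage_set0.
- by rewrite -preimage_bigcup; exact: mpre.
Qed.

HB.instance Definition _ := isMeasure.Build _ _ _ lebesgue_rVS
  lebesgue_rVS0 lebesgue_rVS_ge0 lebesgue_rVS_sigma_additive.

Let lebesgue_rVS_sigma_finite : sigma_finite setT lebesgue_rVS.
Proof.
have /sigma_finiteP[F [TF ndF Foo]] := sigma_finiteT (@lebesgue_measure R).
have /sigma_finiteP[G [TG ndG Goo]] := sigma_finiteT mu.
exists (fun k => @rV_uncons n @^-1` (F k `*` G k)).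
  rewrite -preimage_bigcup (_ : \bigcup_i _ = setT) ?preimage_setT//.
  rewrite -setXTT TF TG predeqE => -[x y]; split; last first.
    move=> [/= [k _ Fkx] [l _ Gly]]; exists (maxn k l) => //; split.
    - by move: x Fkx; exact/subsetPset/ndF/leq_maxl.
    - by move: y Gly; exact/subsetPset/ndG/leq_maxr.
  by move=> [k _ []/= ? ?]; split; exists k.
move=> k; have [? ?] := Foo k; have [? ?] := Goo k; split.
  rewrite -[X in measurable X]setTI; apply: measurable_rV_uncons => //.
  exact: measurableX.
rewrite /lebesgue_rVS /pushforward -comp_preimage.
rewrite (_ : _ \o _ = id) ?preimage_id; last by apply/funext => p; exact: rV_consK.
by rewrite product_measure1E// lte_mul_pinfty// ge0_fin_numE.
Qed.

HB.instance Definition _ := Measure_isSigmaFinite.Build _ _ _ lebesgue_rVS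
  lebesgue_rVS_sigma_finite.

End lebesgue_rV_step.

Fixpoint lebesgue_rV n : {sigma_finite_measure set 'rV[R]_n -> \bar R} :=
  match n with
  | 0 => \d_(0 : 'rV[R]_0)
  | m.+1 => lebesgue_rVS (lebesgue_rV m)
  end.

Lemma lebesgue_rV_box n (A : 'I_n -> set (measurableTypeR R)) :
  (forall i, measurable (A i)) ->
  lebesgue_rV n [set x : 'rV[R]_n | forall i, A i (x ord0 i)] =
  (\prod_(i < n) lebesgue_measure (A i))%E.
Proof.
elim: n A => [|n IH] A mA.
  rewrite big_ord0 /= diracE mem_set//.
  by case.
rewrite big_ord_recl /= /lebesgue_rVS /pushforward.
rewrite (_ : _ @^-1` _ = A ord0 `*`
    [set y : 'rV[R]_n | forall i, A (lift ord0 i) (y ord0 i)]).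
  rewrite product_measure1E//=; last first.
    rewrite (_ : [set _ | _] = \bigcap_(i in [set: 'I_n])
      ((fun y : 'rV[R]_n => y ord0 i : measurableTypeR R) @^-1` A (lift ord0 i))).
      apply: fin_bigcap_measurable => // i _.
      by rewrite -[X in measurable X]setTI; exact: measurable_coord_rV.
    by apply/seteqP; split => y /= h i; [move=> _; exact: h|exact: h].
  by congr (_ * _)%E; rewrite (IH (fun i => A (lift ord0 i))).
apply/seteqP; split => -[t y] /=.
  move=> h; split; first by have := h ord0; rewrite /rV_cons mxE unlift_none.
  by move=> i; have := h (lift ord0 i); rewrite /rV_cons mxE liftK.
move=> [h0 h] i; rewrite /rV_cons mxE.
by case: (unliftP ord0 i) => [j ->|->] //=; exact: h.
Qed.

End lebesgue_rV.

Section calculus_rV.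
Context {R : realType} {n : nat}.
Implicit Types (x y : 'rV[R]_n) (g : 'rV[R]_n -> R) (D : set 'rV[R]_n).

Definition dotp x y : R := \sum_(i < n) x ord0 i * y ord0 i.

(* The Euclidean norm; the library norm `|x| on 'rV[R]_n is the sup norm. *)
Definition enorm x : R := Num.sqrt (dotp x x).

Definition partial (i : 'I_n) g x : R := 'D_(delta_mx ord0 i) g x.

Definition grad g x : 'rV[R]_n := \row_i partial i g x.

Definition laplacian g x : R := \sum_(i < n) partial i (partial i g) x.

Definition iter_partial (s : seq 'I_n) g : 'rV[R]_n -> R := foldr partial g s.

(* D is meant to be open. *)
Definition Ck (k : nat) D g : Prop :=
  (forall s x, (size s < k)%N -> D x ->
     forall i, derivable (iter_partial s g) x (delta_mx ord0 i)) /\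
  (forall s x, (size s <= k)%N -> D x -> {for x, continuous (iter_partial s g)}).

Definition smooth g : Prop := forall k, Ck k setT g.

End calculus_rV.

Definition boundary {T : topologicalType} (A : set T) : set T :=
  closure A `\` interior A.

Section smooth_domain.
Context {R : realType} {N : nat}.
Implicit Types (Theta U : set 'rV[R]_N) (z : 'rV[R]_N).

(* In U, Theta is the region below (b = false) or above (b = true) the graph of
   gamma, the i-th coordinate being a function of the other ones; [col' i x] is
   x with its i-th coordinate removed. *)
Definition graph_chart Theta U (i : 'I_N) (b : bool)
    (gamma : 'rV[R]_N.-1 -> R) : Prop :=
  [/\ open U, smooth gamma &
      forall x, U x -> Theta x <-> (-1) ^+ b * (x ord0 i - gamma (col' i x)) < 0].

Definition smooth_open Theta : Prop :=
  open Theta /\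
  forall z, boundary Theta z ->
    exists U i b gamma, graph_chart Theta U i b gamma /\ U z.

Definition exterior_unit_normal Theta (nu : 'rV[R]_N -> 'rV[R]_N) : Prop :=
  forall U i b gamma, graph_chart Theta U i b gamma ->
  forall z, U z -> boundary Theta z ->
    nu z = ((-1) ^+ b / Num.sqrt (1 + enorm (grad gamma (col' i z)) ^+ 2)) *:
           \row_j oapp (fun k => - partial k gamma (col' i z)) 1 (unlift i j).

(* In a chart the surface element is sqrt (1 + |grad gamma|^2) dy; the charts
   cover the boundary, so this determines sigma on its Borel subsets. *)
Definition surface_measure Theta
    (sigma : {measure set 'rV[R]_N -> \bar R}) : Prop :=
  forall U i b gamma, graph_chart Theta U i b gamma ->
  forall A, measurable A -> A `<=` U ->
    sigma (A `&` boundary Theta) =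
    (\int[lebesgue_rV N.-1]_(y in col' i @` (A `&` boundary Theta))
      (Num.sqrt (1 + enorm (grad gamma y) ^+ 2))%:E)%E.

Definition cutoff (phi : 'rV[R]_N -> R) : Prop :=
  [/\ Ck 1 setT phi, \forall x \near (0 : 'rV[R]_N), phi x = 1 &
      exists M, forall x, M < enorm x -> phi x = 0].

(* I is the value of the integral of g over the boundary of Theta. When g is
   Lebesgue integrable there, this is the Lebesgue integral. The boundary may be
   unbounded and g not absolutely integrable on it: in all cases, I is also
   required to be the limit of the integrals of g multiplied by dilated cutoffs,
   whatever the cutoff (for integrable g, this limit is the Lebesgue integral by
   dominated convergence). *)
Definition boundary_integral Theta (sigma : {measure set 'rV[R]_N -> \bar R})
    (g : 'rV[R]_N -> R) (I : R) : Prop :=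
  (sigma.-integrable (boundary Theta) (EFin \o g) ->
     I = \int[sigma]_(z in boundary Theta) g z) /\
  (forall phi, cutoff phi ->
     (\int[sigma]_(z in boundary Theta) (phi (r^-1 *: z) * g z)) @[r --> +oo]
       --> I).

Definition Qsign Theta (x : 'rV[R]_N) : R := if x \in Theta then 1 else - 1.

End smooth_domain.

Section sobolev.
Context {R : realType}.

Definition sobolev_exponent (N : nat) : R := (2 * N%:R) / (N%:R - 2).

(* Membership in D^{1,2}(R^N) of a function of class C^1, whose weak gradient is
   its classical one. *)
Definition D12_C1 (N : nat) (u : 'rV[R]_N -> R) : Prop :=
  u \in Lfun (lebesgue_rV N) (sobolev_exponent N)%:E /\
  forall i, partial i u \in Lfun (lebesgue_rV N) 2%:E.

Definition primitive0 (f : R -> R) (w : R) : R :=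
  if 0 <= w then \int[lebesgue_measure]_(t in `[0, w]) f t
  else - \int[lebesgue_measure]_(t in `[w, 0]) f t.

End sobolev.

(* Main.v *)
Require Import Defs.
From HB Require Import structures.
From mathcomp Require Import all_boot all_order all_algebra.
From mathcomp Require Import all_classical all_reals all_analysis.
From mathcomp Require Import measurable_realfun ring lra.
Import Order.TTheory GRing.Theory Num.Theory.
Import numFieldNormedType.Exports.
Local Open Scope classical_set_scope.
Local Open Scope ring_scope.

(** Write [T = (x . grad u) grad u - |grad u|^2 x / 2]. Off the boundary of
Theta, u is of class C^2 and the equation gives [div (T + Q F(u) x) = (1 - N/2)
|grad u|^2 + N Q F(u)]; the identity follows by integration, the jump of Q
across the boundary producing [2 F(u) x . nu].

Since the second derivatives of u may blow up at the boundary, the divergence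
theorem is not applied on Theta. Near a boundary point, let s be the signed
height over the graph. The field is multiplied by [p (k s)], where p vanishes
near 0 and is constant away from it: the product is of class C^1 and compactly
supported on the whole space, so its divergence has zero integral by Fubini's
theorem, and the term [k p' (k s)] concentrates on the graph when k tends to
infinity. The continuous field T, with the same constant on both sides,
contributes nothing, and the field [F(u) x], with opposite constants,
contributes the surface integral. Cutoffs subordinate to a finite cover reduce
an arbitrary compactly supported test function to these local cases.

Taking [phi (x / r)] as test function, the error term [grad (phi (x / r)) . (T +
Q F(u) x)] is bounded by a multiple of [|grad u|^2 + |F(u)|] and tends to 0
pointwise, so dominated convergence concludes. *)

Set Implicit Arguments.
Unset Strict Implicit.
Unset Printing Implicit Defensive.

(** * Lebesgue measure on row vectors *)

(** The field T arises from multiplying the equation by x . grad u, the derivative of u along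
    dilations. Second derivatives enter only through its divergence, where the equation and the
    symmetry of the Hessian remove them: the divergence is locally bounded even where the Hessian
    blows up, and this is what makes the limit in k possible.

    When the boundary is unbounded, the surface integral is not known to converge absolutely. Its
    value B is therefore defined from the volume side, as half the integral of (1 - N/2) |grad u|^2
    + N Q F(u), and the work consists in showing that B is the boundary integral. The stated
    equation is then algebra, because (1 - N/2) / N is the opposite of the inverse of the Sobolev
    exponent. *)

Definition box {R : realType} {n : nat} (A : 'I_n -> set (measurableTypeR R)) :
  set 'rV[R]_n := [set x | forall i, A i (x ord0 i)].

Lemma measurable_box {R : realType} {n : nat}
    (A : 'I_n -> set (measurableTypeR R)) :
  (forall i, measurable (A i)) -> measurable (box A).
Proof.
move=> mA; rewrite (_ : box A = \bigcap_(i in [set: 'I_n])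
      ((fun y : 'rV[R]_n => y ord0 i : measurableTypeR R) @^-1` A i)).
  apply: fin_bigcap_measurable => // i _.
  by rewrite -[X in measurable X]setTI; exact: measurable_coord_rV.
by apply/seteqP; split => y /= h i; [move=> _; exact: h|exact: h].
Qed.

(** The library norm is the sup norm. This is the link between the topology and the product
    sigma-algebra. *)
Lemma rV_ballE {R : realType} {n : nat} (x : 'rV[R]_n) (e : R) : 0 < e ->
  ball x e = box (fun i => ball (x ord0 i) e).
Proof.
move=> e0; apply/seteqP; split => y /=; first by move=> [_ h] i; exact: h.
by move=> h; split => // i j; rewrite [i]ord1; exact: h.
Qed.

(** The sigma-algebra is generated by the coordinates, so an open set is exhausted by the countably
    many balls with rational centre and radius 1 / (k + 1) that it contains. *)
Lemma open_measurable_rV {R : realType} {n : nat} (U : set 'rV[R]_n) :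
  open U -> measurable U.
Proof.
move=> oU.
pose Q := ('rV[rat]_n * nat)%type.
pose B (q : Q) : set 'rV[R]_n := ball (map_mx ratr q.1 : 'rV[R]_n) q.2.+1%:R^-1.
pose F (q : Q) := if `[< B q `<=` U >] then B q else set0.
have -> : U = \bigcup_q F q.
  apply/seteqP; split; last first.
    by move=> x [q _]; rewrite /F; case: asboolP => // h; exact: h.
  move=> x Ux; have /nbhs_ballP[e/= e0 xeU] : nbhs x U by exact: open_nbhs_nbhs.
  have [k ke] : exists k : nat, k.+1%:R^-1 < e / 2.
    have e20 : 0 < e / 2 by rewrite divr_gt0.
    exists (Num.Def.truncn (e / 2)^-1).
    rewrite -[ltRHS]invrK ltf_pV2 ?posrE ?invr_gt0//.
    exact: truncnS_gt.
  have /choice[q qx] : forall i : 'I_n, exists q : rat,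
      ball (x ord0 i) k.+1%:R^-1 (ratr q : R).
    move=> i; have [q] := @rat_in_itvoo R (x ord0 i) (x ord0 i + k.+1%:R^-1)
      ltac:(by rewrite ltrDl).
    rewrite in_itv/= => /andP[q1 q2]; exists q.
    have k0 : 0 < k.+1%:R^-1 :> R by [].
    move: (ratr q : R) (k.+1%:R^-1 : R) k0 q1 q2 => q' r k0 q1 q2.
    by rewrite /ball/= ltr_norml; apply/andP; split; lra.
  have Bx : B (\row_i q i, k) x.
    rewrite /B rV_ballE// => i /=; apply: ball_sym.
    by rewrite !mxE; exact: qx.
  exists (\row_i q i, k) => //; rewrite /F; case: asboolP => // nB.
  exfalso; apply: nB => y By; apply: xeU.
  apply: (@le_ball _ _ _ (k.+1%:R^-1 + k.+1%:R^-1)).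
    by move: (k.+1%:R^-1 : R) ke => r; lra.
  by apply: ball_triangle By; exact: ball_sym.
apply: countable_bigcupT_measurable; first exact: countableP.
move=> q; rewrite /F; case: ifPn => // _; rewrite /B rV_ballE//.
apply: measurable_box => i.
exact: open_measurable (ball_open _ _).
Qed.

Lemma continuous_measurable_fun_rV {R : realType} {n : nat}
    (D : set 'rV[R]_n) (g : 'rV[R]_n -> measurableTypeR R) :
  continuous (g : 'rV[R]_n -> R) -> measurable_fun D g.
Proof.
move=> cg; apply: measurable_funTS.
apply: (measurability _ (RGenOpens.measurableE R)) => _ [_ [a [b ->] <-]].
rewrite setTI; apply: open_measurable_rV.
by apply: open_comp; [move=> x _; exact: cg|exact: interval_open].
Qed.

Lemma segmentE {R : realType} (r : R) :
  [set t : R | - r <= t <= r] = `[- r, r]%classic.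
Proof. by apply/seteqP; split => t /=; rewrite in_itv. Qed.

Definition cube {R : realType} (n : nat) (r : R) : set 'rV[R]_n :=
  box (fun=> [set t : R | - r <= t <= r]).
Arguments cube {R} n r.

Lemma measurable_cube {R : realType} (n : nat) (r : R) :
  measurable (cube n r).
Proof.
by apply: measurable_box => _; rewrite segmentE; exact: measurable_itv.
Qed.

Lemma lebesgue_rV_cube {R : realType} (n : nat) (r : R) :
  (lebesgue_rV n (cube n r) < +oo)%E.
Proof.
rewrite /cube segmentE.
rewrite [X in (X < _)%E]lebesgue_rV_box; last first.
  by move=> _; exact: measurable_itv.
set I : set R := `[- r, r]%classic.
suff : (\prod_(i < n) lebesgue_measure I)%E \is a fin_num.
  by rewrite fin_numElt => /andP[].
elim/big_ind: _ => [//|a b|j _]; first exact: fin_numM.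
by rewrite /I lebesgue_measure_itv/=; case: ifP.
Qed.

Lemma coord_le_norm {R : realType} {n : nat} (x : 'rV[R]_n) i :
  `|x ord0 i| <= `|x|.
Proof.
rewrite [leRHS]/Num.Def.normr/= mx_normrE.
by apply: (le_trans _ (le_bigmax _ _ (ord0, i))).
Qed.

Lemma cubeE {R : realType} (n : nat) (r : R) : 0 <= r ->
  cube n r = [set x | `|x| <= r].
Proof.
move=> r0; apply/seteqP; split => x /= h.
  rewrite [leLHS]/Num.Def.normr/= mx_normrE; apply/bigmax_leP; split =>
    // -[j i] _ /=.
  by rewrite [j]ord1 ler_norml; exact: h.
by move=> i /=; rewrite -ler_norml (le_trans (coord_le_norm _ _)).
Qed.

(** Boxes are stable under intersection and generate the sigma-algebra, and the cubes exhaust the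
    space with finite measure. *)
Lemma measure_rV_unique {R : realType} {n : nat}
    (m1 m2 : {measure set 'rV[R]_n -> \bar R}) :
  (forall A, (forall i, measurable (A i)) -> m1 (box A) = m2 (box A)) ->
  (forall k : nat, (m1 (cube n k%:R) < +oo)%E) ->
  forall A, measurable A -> m1 A = m2 A.
Proof.
move=> m12 m1oo.
pose G := [set B | exists2 A : 'I_n -> set (measurableTypeR R),
  (forall i, measurable (A i)) & B = box A].
apply: (measure_unique G (fun k => cube n k%:R)) => //.
- apply/seteqP; split.
    apply: smallest_sub; first exact: smallest_sigma_algebra.
    rewrite -bigcup_seq; apply: bigcup_sub => i _ B [C mC <-].
    apply: sub_sigma_algebra.
    exists (fun j => if j == i then C else setT).
      by move=> j; case: ifP.
    rewrite setTI; apply/seteqP; split => x /=.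
      by move=> Cx j; case: ifP => // /eqP ->.
    by move/(_ i); rewrite eqxx.
  apply: smallest_sub; first exact: sigma_algebra_measurable.
  by move=> B [A mA ->]; exact: measurable_box.
- move=> _ _ [A mA ->] [B mB ->]; exists (fun i => A i `&` B i).
    by move=> i; exact: measurableI.
  by apply/seteqP; split => x; [move=> [h1 h2] i; split|
    move=> h; split => i; case: (h i)].
- move=> k; exists (fun=> [set t : R | - k%:R <= t <= k%:R]) => //.
  by move=> _; rewrite segmentE; exact: measurable_itv.
- rewrite -subTset => x _; exists (Num.Def.truncn `|x|).+1 => //.
  by rewrite cubeE//=; exact/ltW/truncnS_gt.
- by move=> _ [A mA ->]; exact: m12.
Qed.

(** * Fubini's theorem along an arbitrary coordinate *)

Section insertion.
Context {R : realType} {n : nat} (i : 'I_n.+1).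
Implicit Types (t : R) (y : 'rV[R]_n) (x : 'rV[R]_n.+1).

Definition insert t y : 'rV[R]_n.+1 := \row_j oapp (y ord0) t (unlift i j).

Lemma insert_self t y : insert t y ord0 i = t.
Proof. by rewrite mxE unlift_none. Qed.

Lemma insert_lift t y k : insert t y ord0 (lift i k) = y ord0 k.
Proof. by rewrite mxE liftK. Qed.

Lemma col'_insert t y : col' i (insert t y) = y.
Proof. by apply/rowP => k; rewrite mxE insert_lift. Qed.

Lemma insert_col' x : insert (x ord0 i) (col' i x) = x.
Proof.
apply/rowP => j; rewrite mxE.
by case: (unliftP i j) => [k ->|->] /=; rewrite ?mxE.
Qed.

Definition insert_pair (p : measurableTypeR R * 'rV[R]_n) := insert p.1 p.2.

Lemma measurable_insert : measurable_fun setT insert_pair.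
Proof.
apply: measurable_fun_rV => j; rewrite /insert_pair /insert.
under eq_fun do rewrite mxE.
case: (unlift i j) => [k|] /=; last exact: measurable_fst.
exact: (measurableT_comp (measurable_coord_rV k) measurable_snd).
Qed.

(** [lebesgue_rV] is built by adding coordinate 0, whereas charts are graphs over any coordinate
    hyperplane. Both measures give a box the product of the lengths of its sides, in whatever order
    the factors are taken. *)
Lemma lebesgue_rV_insert (A : set 'rV[R]_n.+1) : measurable A ->
  lebesgue_rV n.+1 A =
  pushforward (@lebesgue_measure R \x lebesgue_rV n)%E insert_pair A.
Proof.
have boxE (B : 'I_n.+1 -> set (measurableTypeR R)) :
    (forall j, measurable (B j)) -> lebesgue_rV n.+1 (box B) =
    pushforward (@lebesgue_measure R \x lebesgue_rV n)%E insert_pair (box B).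
  move=> mB; rewrite lebesgue_rV_box// /pushforward.
  rewrite (_ : _ @^-1` _ = B i `*` box (fun k => B (lift i k))).
    rewrite product_measure1E//=; last exact: measurable_box.
    by rewrite [in RHS]lebesgue_rV_box// (bigD1_ord i).
  apply/seteqP; split => -[t y] /=.
    move=> h; split; first by have := h i; rewrite insert_self.
    by move=> k; have := h (lift i k); rewrite insert_lift.
  move=> [h0 h] j; case: (unliftP i j) => [k ->|->].
    by rewrite insert_lift; exact: h.
  by rewrite insert_self.
pose mi := isMeasurableFun.Build _ _ _ _ _ measurable_insert.
pose ip : {mfun _ >-> _} := HB.pack insert_pair mi.
apply: (@measure_rV_unique _ _ (lebesgue_rV n.+1)
  (pushforward (@lebesgue_measure R \x lebesgue_rV n)%E ip)) => //.
by move=> k; exact: lebesgue_rV_cube.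
Qed.

End insertion.

Lemma integral_rV_insert {R : realType} {n : nat} (i : 'I_n.+1)
    (f : 'rV[R]_n.+1 -> \bar R) : (lebesgue_rV n.+1).-integrable setT f ->
  (\int[lebesgue_rV n.+1]_x f x =
   \int[lebesgue_measure \x lebesgue_rV n]_p f (insert_pair i p))%E /\
  (lebesgue_measure \x lebesgue_rV n)%E.-integrable setT (f \o insert_pair i).
Proof.
move=> fi; have mf := measurable_int _ fi.
have maf : measurable_fun setT (abse \o f) by exact: measurableT_comp.
have mfi : measurable_fun setT (f \o insert_pair i).
  by apply: measurableT_comp => //; exact: measurable_insert.
have eqm (g : _ -> \bar R) : measurable_fun setT g -> (forall x, 0 <= g x)%E ->
    (\int[lebesgue_rV n.+1]_x g x =
     \int[lebesgue_measure \x lebesgue_rV n]_p g (insert_pair i p))%E.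
  move=> mg g0; pose mi := isMeasurableFun.Build _ _ _ _ _ (@measurable_insert
    R n i).
  pose ip : {mfun _ >-> _} := HB.pack (@insert_pair R n i) mi.
  rewrite (eq_measure_integral
    (pushforward (@lebesgue_measure R \x lebesgue_rV n)%E ip)).
    by rewrite ge0_integral_pushforward ?preimage_setT.
  by move=> A mA _; exact: lebesgue_rV_insert.
split; last first.
  apply/integrableP; split => //; move/integrableP : fi => [_].
  by rewrite (eqm _ maf) => [//|x]; exact: abse_ge0.
have mfp := measurable_funepos mf; have mfn := measurable_funeneg mf.
rewrite integralE [RHS]integralE (eqm _ mfp (funepos_ge0 f)) (eqm _ mfn
  (funeneg_ge0 f)).
  by congr (_ - _)%E; apply: eq_integral => p _; rewrite ?funeposE ?funenegE.
Qed.

(** The right-hand side is a scaled pushforward measure; it agrees with Lebesgue measure on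
    half-open intervals, which determines it. *)
Lemma lebesgue_measure_affine {R : realType} (a e : R) (e0 : 0 < e)
    (A : set (measurableTypeR R)) : measurable A ->
  lebesgue_measure A =
  (e%:E * lebesgue_measure ((fun t => a + e * t)%R @^-1` A))%E.
Proof.
have mphi : measurable_fun setT (fun t : R => a + e * t).
  by apply: measurable_funD => //; exact: measurable_funM.
pose phi : measurableTypeR R -> measurableTypeR R := fun t => a + e * t.
pose m : {measure set (measurableTypeR R) -> \bar R} :=
  mscale (NngNum (ltW e0)) (pushforward (@lebesgue_measure R) phi).
move=> mA; transitivity (m mphi A); last by [].
apply: (@lebesgue_measure_unique _ (m mphi)) => // _ [[b c] _ <-].
have pE : phi @^-1` `]b, c]%classic = `](b - a) / e, (c - a) / e]%classic.
  apply/seteqP; split => t /=; rewrite !in_itv/= ltr_pdivrMr// ler_pdivlMr//;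
    by rewrite ltrBlDl lerBrDl [t * e]mulrC.
transitivity (e%:E * lebesgue_measure (phi @^-1` `]b, c]%classic))%E;
  last by [].
rewrite pE !lebesgue_measure_itv/= !lte_fin ltr_pM2r ?invr_gt0// ltrD2r.
case: ifPn => _; last by rewrite mule0.
by rewrite -!EFinB -EFinM; congr EFin; field; rewrite gt_eqF.
Qed.

Lemma integral_affine {R : realType} (a e : R) (f : R -> \bar R) : 0 < e ->
  lebesgue_measure.-integrable setT f ->
  (\int[lebesgue_measure]_t f t =
   e%:E * \int[lebesgue_measure]_t f (a + e * t)%R)%E.
Proof.
move=> e0 fi; have mf := measurable_int _ fi.
have maf : measurable_fun setT (abse \o f) by exact: measurableT_comp.
have mphi : measurable_fun setT (fun t : R => a + e * t).
  by apply: measurable_funD => //; exact: measurable_funM.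
have eqm (g : _ -> \bar R) : measurable_fun setT g -> (forall x, 0 <= g x)%E ->
    (\int[lebesgue_measure]_x g x =
     e%:E * \int[lebesgue_measure]_t g (a + e * t)%R)%E.
  move=> mg g0;
  pose phi : measurableTypeR R -> measurableTypeR R := fun t => a + e * t.
  pose m : {measure set (measurableTypeR R) -> \bar R} :=
  mscale (NngNum (ltW e0)) (pushforward (@lebesgue_measure R) phi).
  rewrite (eq_measure_integral (m mphi)).
    rewrite ge0_integral_mscale//=.
    by rewrite ge0_integral_pushforward ?preimage_setT.
  by move=> A mA _; exact: lebesgue_measure_affine.
have mfp := measurable_funepos mf; have mfn := measurable_funeneg mf.
rewrite integralE (eqm _ mfp (funepos_ge0 f)) (eqm _ mfn (funeneg_ge0 f)).
rewrite -muleBr//.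
  rewrite [in RHS]integralE; congr (_ * (_ - _))%E; apply: eq_integral => t _;
    by rewrite ?funeposE ?funenegE.
(* Side condition of [muleBr]: the difference must not be of the form infinity minus infinity. If
   the integral of the positive part of f (a + e t) were infinite, so would be that of |f|. *)
move/integrableP : fi => [_].
rewrite (eqm _ maf) => [foo|x]; last exact: abse_ge0.
apply: fin_num_adde_defr; rewrite fin_num_abs.
rewrite gee0_abs; last exact: integral_ge0.
rewrite ltey; apply/eqP => foo'.
have : (\int[lebesgue_measure]_t (f^\+ (a + e * t)%R) <=
        \int[lebesgue_measure]_t (abse \o f) (a + e * t)%R)%E.
  apply: ge0_le_integral => //.
  - by apply: measurableT_comp mphi.
  - by apply: measurableT_comp mphi; exact: maf.
  - by move=> t _ /=; rewrite -/((abse \o f) _) fune_abse leeDl.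
rewrite foo' leye_eq => /eqP foo2.
by move: foo; rewrite foo2 gt0_muley.
Qed.

(** * Functions of class C^1 with explicit gradients *)

Section derivative_along.
Context {R : realType} {V W : normedModType R}.

(** Since [A] maps the line through [x] affinely, the two difference quotients are the same
    function. This one rule serves lines, the removal of a coordinate, and dilations. *)
Lemma is_derive_precomp (A : W -> V) (g : V -> R) (x v : W) (w : V) (d : R) :
  (forall h : R, A (h *: v + x) = h *: w + A x) ->
  is_derive (A x) w g d <-> is_derive x v (g \o A) d.
Proof.
move=> Ah.
have E : (fun h : R => h^-1 *: (((g \o A) \o shift x) (h *: v) - (g \o A) x)) =
         (fun h : R => h^-1 *: ((g \o shift (A x)) (h *: w) - g (A x))).
  by apply/funext => h /=; rewrite Ah.
split=> -[]; rewrite /derivable /derive => dg gd.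
  by apply: DeriveDef; rewrite /derivable /derive E.
by apply: DeriveDef; rewrite /derivable /derive -E.
Qed.

End derivative_along.

Section derivative_line.
Context {R : realType} {V : normedModType R}.

Lemma is_derive_line (g : V -> R) (x v : V) (t d : R) :
  is_derive (t *: v + x) v g d <->
  is_derive t 1 (fun t => g (t *: v + x)) d.
Proof.
apply: (is_derive_precomp (A := fun t : R => t *: v + x)) => h.
by rewrite addrA -scalerDl [h *: 1]mulr1.
Qed.

Lemma is_derive_comp1 (p : R -> R) (g : V -> R) (x v : V) (dp dg : R) :
  is_derive (g x) 1 p dp -> is_derive x v g dg ->
  is_derive x v (p \o g) (dp * dg).
Proof.
move=> hp hg.
have x0 : x = 0 *: v + x by rewrite scale0r add0r.
rewrite x0; apply/is_derive_line.
apply: (@is_derive1_comp _ p (fun t => g (t *: v + x))); rewrite -?x0//.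
by apply/is_derive_line; rewrite -x0.
Qed.

Lemma is_derive_scale_dir (g : V -> R) (x v : V) (a d : R) :
  is_derive x v g d -> is_derive x (a *: v) g (a * d).
Proof.
move=> hg.
have x0 w : x = 0 *: w + x by rewrite scale0r add0r.
rewrite (x0 (a *: v)); apply/is_derive_line.
have -> : (fun t => g (t *: (a *: v) + x)) = (fun t =>
  g (t *: v + x)) \o ( *%R a).
  by apply/funext => t /=; rewrite scalerA mulrC.
rewrite mulrC; apply: is_derive1_comp.
  by apply/is_derive_line; rewrite mulr0 -x0.
have h : is_derive (0 : R) 1 ( *%R a) _ :=
  is_deriveZ a (is_derive_id (0 : R) (1 : R)).
by apply: (is_derive_eq h); exact: mulr1.
Qed.

End derivative_line.

Lemma near_continuous {T U : topologicalType} (f g : T -> U) (x : T) :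
  (\forall y \near x, f y = g y) ->
  {for x, continuous f} -> {for x, continuous g}.
Proof.
move=> fg fc; suff : g @ x --> g x by [].
by rewrite -(nbhs_singleton fg); apply: cvg_trans fc; exact: near_eq_cvg.
Qed.

Lemma near_forall {T : topologicalType} (x : T) (P : T -> Prop) :
  (forall y, P y) -> \forall y \near x, P y.
Proof. by move=> h; apply: nearW. Qed.

Section C1_at.
Context {R : realType} {n : nat}.
Implicit Types (x y : 'rV[R]_n) (g h : 'rV[R]_n -> R).
Implicit Types (dg dh : 'I_n -> 'rV[R]_n -> R).

Definition basis (i : 'I_n) : 'rV[R]_n := delta_mx ord0 i.

(* The gradient is an argument, not [partial _ g]: the rules below then hold at
   a single point and give the derivatives as explicit terms. *)
Definition C1_at x g dg : Prop :=
  {for x, continuous g} /\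
  forall i, is_derive x (basis i) g (dg i x) /\ {for x, continuous (dg i)}.

Lemma Ck1_C1_at (D : set 'rV[R]_n) g x : Ck 1 D g -> D x ->
  C1_at x g (fun i => partial i g).
Proof.
move=> [gd gc] Dx; split; first exact: (gc [::]).
move=> i; split; last exact: (gc [:: i]).
exact/derivableP/(gd [::]).
Qed.

Lemma Ck2_C1_at (D : set 'rV[R]_n) g x j : Ck 2 D g -> D x ->
  C1_at x (partial j g) (fun i => partial i (partial j g)).
Proof.
move=> [gd gc] Dx; split; first exact: (gc [:: j]).
move=> i; split; last exact: (gc [:: i; j]).
exact/derivableP/(gd [:: j]).
Qed.

Lemma C1_at_near x g dg h dh :
  (\forall y \near x, g y = h y) ->
  (forall i, \forall y \near x, dg i y = dh i y) ->
  C1_at x g dg -> C1_at x h dh.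
Proof.
move=> gh dgh [gc gd]; split.
  exact: near_continuous gc.
move=> i; have [gdi gci] := gd i; split.
  by rewrite -(nbhs_singleton (dgh i)); exact: near_eq_is_derive gdi.
exact: near_continuous gci.
Qed.

Lemma C1_at_eq x g dg dh : (forall i y, dg i y = dh i y) ->
  C1_at x g dg -> C1_at x g dh.
Proof.
by move=> e; apply: C1_at_near => [|i]; apply: near_forall => // y; exact: e.
Qed.

Lemma C1_at_cst x (c : R) : C1_at x (fun=> c) (fun _ _ => 0).
Proof.
split; first exact: cst_continuous.
by move=> i; split; [exact: is_derive_cst|exact: cst_continuous].
Qed.

Lemma C1_at_coord x j : C1_at x (fun y => y ord0 j) (fun i _ => (i == j)%:R).
Proof.
split; first exact: coord_continuous.
move=> i; split; last exact: cst_continuous.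
have x0 : x = 0 *: basis i + x by rewrite scale0r add0r.
rewrite x0; apply/(@is_derive_line _ _ (fun y : 'rV[R]_n => y ord0 j)).
have -> : (fun t : R => (t *: basis i + x) ord0 j) =
          ((i == j)%:R \*: id) + cst (x ord0 j).
  by apply/funext => t /=; rewrite !mxE eqxx /= [j == i]eq_sym mulrC.
have h := is_deriveD (is_deriveZ (i == j)%:R (is_derive_id (0 : R) (1 : R)))
  (is_derive_cst (x ord0 j) (0 : R) (1 : R)).
by apply: (is_derive_eq h); rewrite addr0; exact: mulr1.
Qed.

Lemma C1_atD x g dg h dh : C1_at x g dg -> C1_at x h dh ->
  C1_at x (fun y => g y + h y) (fun i y => dg i y + dh i y).
Proof.
move=> [gc gd] [hc hd]; split; first exact: continuousD.
move=> i; have [? ?] := gd i; have [? ?] := hd i.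
by split; [exact: is_deriveD|exact: continuousD].
Qed.

Lemma C1_atM x g dg h dh : C1_at x g dg -> C1_at x h dh ->
  C1_at x (fun y => g y * h y) (fun i y => g y * dh i y + h y * dg i y).
Proof.
move=> [gc gd] [hc hd]; split; first exact: continuousM.
move=> i; have [? ?] := gd i; have [? ?] := hd i; split.
  exact: is_deriveM.
by apply: continuousD; exact: continuousM.
Qed.

Lemma C1_atZ x (c : R) g dg : C1_at x g dg ->
  C1_at x (fun y => c * g y) (fun i y => c * dg i y).
Proof.
move=> hg; apply: C1_at_eq (C1_atM (C1_at_cst x c) hg) => i y /=.
by rewrite mulr0 addr0.
Qed.

Lemma C1_at_sum (I : Type) (r : seq I) x (g : I -> 'rV[R]_n -> R)
    (dg : I -> 'I_n -> 'rV[R]_n -> R) :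
  (forall k, C1_at x (g k) (dg k)) ->
  C1_at x (fun y => \sum_(k <- r) g k y) (fun i y => \sum_(k <- r) dg k i y).
Proof.
move=> hg; elim: r => [|k r IH].
  apply: (C1_at_near _ _ (C1_at_cst x 0)) => [|i];
    by apply: near_forall => y; rewrite big_nil.
apply: (C1_at_near _ _ (C1_atD (hg k) IH)) => [|i];
  by apply: near_forall => y; rewrite big_cons.
Qed.

Lemma C1_at_comp x (p dp : R -> R) g dg :
  (forall t : R, is_derive t 1 p (dp t)) -> continuous dp -> C1_at x g dg ->
  C1_at x (fun y => p (g y)) (fun i y => dp (g y) * dg i y).
Proof.
move=> hp cdp [gc gd].
have cp : {for g x, continuous p}.
  by apply/differentiable_continuous/derivable1_diffP; have [] := hp (g x).
split; first exact: continuous_comp.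
move=> i; have [? ?] := gd i; split.
  exact: (@is_derive_comp1 _ _ p).
apply: continuousM => //; apply: (@continuous_comp _ _ _ g dp) => //;
  exact: cdp.
Qed.

End C1_at.

(** * Transition functions of one real variable *)

Section bumps.
Context {R : realType}.
Implicit Types t : R.

(** The simplest function of class C^1 that is zero on a half-line and not on the other one; the
    transitions are combinations of its translates. *)
Definition pos_sq t : R := Num.max t 0 ^+ 2.

Lemma is_derive_pos_sq t : is_derive t 1 pos_sq (2 * Num.max t 0).
Proof.
case: (ltrgtP t 0) => [t0|t0|->].
- rewrite mulr0; apply: near_eq_is_derive (is_derive_cst (0 : R) t 1).
  near=> s; rewrite /pos_sq max_r ?expr0n//=.
  by apply: ltW; near: s; exact: (lt_nbhsl t0).
- apply: (near_eq_is_derive (f := (fun s : R => s) ^+ 2)).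
    near=> s; rewrite /pos_sq max_l//.
    by apply: ltW; near: s; exact: (lt_nbhsr t0).
  by apply: (is_derive_eq (is_deriveX 2 (is_derive_id t (1 : R))));
    exact: mulr1.
- rewrite mulr0; apply/is_derive1_caratheodory.
  exists (fun s => Num.max s 0); split => //; last by rewrite maxxx.
    move=> s; rewrite /pos_sq maxxx expr0n/= !subr0.
    by case: (leP s 0) => s0; rewrite ?expr0n/= ?mul0r ?expr2.
  by apply: continuous_max => //; exact: cst_continuous.
Unshelve. all: by end_near. Qed.

(* Two integrations of 4 on [0, 1/2] and -4 on [1/2, 1] give a transition of
   class C^1 from 0 to 1. *)
Definition step t : R :=
  2 * pos_sq t - 4 * pos_sq (t - 2^-1) + 2 * pos_sq (t - 1).

Definition dstep t : R :=
  4 * Num.max t 0 - 8 * Num.max (t - 2^-1) 0 + 4 * Num.max (t - 1) 0.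

Lemma is_derive_affine (p : R -> R) (a b t d : R) :
  is_derive (a * t + b) 1 p d ->
  is_derive t 1 (fun s => p (a * s + b)) (a * d).
Proof.
move=> hp; rewrite mulrC; apply: (@is_derive1_comp _ p (fun s =>
  a * s + b)) => //.
have h := is_deriveD (is_deriveZ a (is_derive_id t (1 : R)))
  (is_derive_cst b t (1 : R)).
by apply: (is_derive_eq h); rewrite addr0; exact: mulr1.
Qed.

Lemma is_derive_step t : is_derive t 1 step (dstep t).
Proof.
have sh (c : R) : is_derive t 1 (fun s => pos_sq (s - c)) (2 * Num.max (t - c)
  0).
  have := @is_derive_affine pos_sq 1 (- c) t (2 * Num.max (t - c) 0).
  rewrite !mul1r => /(_ (is_derive_pos_sq _)).
  by congr (is_derive _ _ _ _); apply/funext => s; rewrite mul1r.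
have h := is_deriveD (is_deriveB (is_deriveZ 2 (is_derive_pos_sq t))
  (is_deriveZ 4 (sh 2^-1))) (is_deriveZ 2 (sh 1)).
by refine (@is_derive_eq _ _ _ step _ _ _ _ h _);
  rewrite /dstep /GRing.scale/=; ring.
Qed.

Lemma dstep_continuous : continuous dstep.
Proof.
move=> t.
have k (c : R) : {for t, continuous (fun=> c : R)} by exact: cst_continuous.
have cm0 : {for t, continuous (fun s : R => Num.max s 0)}.
  exact: (continuous_max _ (k 0)).
have cm (c : R) : {for t, continuous (fun s : R => Num.max (s - c) 0)}.
  by apply: (continuous_max _ (k 0)); exact: (continuousB _ (k c)).
exact: (continuousD (continuousB (continuousM (k 4) cm0)
  (continuousM (k 8) (cm 2^-1))) (continuousM (k 4) (cm 1))).
Qed.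

Lemma step_le0 t : t <= 0 -> step t = 0.
Proof. by move=> t0; rewrite /step /pos_sq !max_r; [ring|lra..]. Qed.

Lemma dstep_le0 t : t <= 0 -> dstep t = 0.
Proof. by move=> t0; rewrite /dstep !max_r; [ring|lra..]. Qed.

Lemma step_ge1 t : 1 <= t -> step t = 1.
Proof.
move=> t1; rewrite /step /pos_sq !max_l; [|lra..].
have e2 : 2 * 2^-1 = 1 :> R by rewrite divff.
have e4 : 4 * (2^-1 * 2^-1) = 1 :> R.
  by rewrite (_ : 4 = 2 * 2); [rewrite mulrACA e2 mulr1|ring].
by field.
Qed.

Lemma dstep_ge1 t : 1 <= t -> dstep t = 0.
Proof. by move=> t1; rewrite /dstep !max_l; [field|lra..]. Qed.

Lemma step_ge0_le1 t : 0 <= step t <= 1.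
Proof.
case: (leP t 0) => t0; first by rewrite step_le0// lexx ler01.
case: (leP 1 t) => t1; first by rewrite step_ge1// lexx ler01.
have e1 : Num.max t 0 = t by rewrite max_l// ltW.
have e2 : Num.max (t - 1) 0 = 0 by rewrite max_r//; lra.
rewrite /step /pos_sq e1 e2.
case: (leP t 2^-1) => t2.
  by rewrite max_r; [nra|lra].
by rewrite max_l; [nra|lra].
Qed.

End bumps.

(** * Integrals of derivatives *)

Lemma integrable_indic_lty d (T : measurableType d) (R : realType)
    (mu : {measure set T -> \bar R}) (A : set T) : measurable A ->
  (mu A < +oo)%E -> mu.-integrable setT (EFin \o \1_A).
Proof.
move=> mA Aoo; apply/integrableP; split; first exact/measurable_EFinP.
rewrite (eq_integral (fun x => (\1_A x)%:E)).
  by rewrite integral_indic// setIT.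
by move=> t _; rewrite gee0_abs// lee_fin.
Qed.

Section locally_bounded.
Context {R : realType} {n : nat}.
Implicit Types (g h : 'rV[R]_n -> R).

(** Weaker than continuity so as to include [Qsign], and stable under sums and products; with
    compact support it gives integrability. *)
Definition locally_bounded g : Prop :=
  measurable_fun setT g /\
  forall r : R, exists C : R, forall x, `|x| <= r -> `|g x| <= C.

Definition compactly_supported g : Prop :=
  exists r : R, forall x, r < `|x| -> g x = 0.

Lemma continuous_locally_bounded g : continuous g -> locally_bounded g.
Proof.
move=> cg; split; first exact: continuous_measurable_fun_rV.
move=> r; have cptA : compact [set x : 'rV[R]_n | `|x| <= r].
  apply: bounded_closed_compact.
    by exists r; split; [exact: num_real|move=> s rs x /= xr;
      exact/(le_trans xr)/ltW].
  rewrite (_ : [set _ | _] = (fun x : 'rV[R]_n =>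
    `|x|) @^-1` [set t | t <= r]) //.
  by apply: closed_comp; [move=> x _; exact: norm_continuous|exact: closed_le].
have /compact_bounded[M [_ mrt]] : compact (g @` [set x : 'rV[R]_n | `|x| <=
  r]).
  apply: continuous_compact => //; exact: continuous_subspaceT.
exists (M + 1) => x xr; apply: (mrt (M + 1)); first by rewrite ltrDl.
by exists x.
Qed.

Lemma locally_boundedD g h : locally_bounded g -> locally_bounded h ->
  locally_bounded (fun x => g x + h x).
Proof.
move=> [mg bg] [mh bh]; split; first exact: measurable_funD.
move=> r; have [C hC] := bg r; have [C' hC'] := bh r; exists (C + C') => x xr.
by rewrite (le_trans (ler_normD _ _))// lerD// ?hC ?hC'.
Qed.

Lemma locally_boundedM g h : locally_bounded g -> locally_bounded h ->
  locally_bounded (fun x => g x * h x).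
Proof.
move=> [mg bg] [mh bh]; split; first exact: measurable_funM.
move=> r; have [C hC] := bg r; have [C' hC'] := bh r; exists (C * C') => x xr.
by rewrite normrM ler_pM// ?hC ?hC'.
Qed.

Lemma locally_bounded_cst (c : R) : locally_bounded (fun=> c).
Proof. by apply: continuous_locally_bounded; exact: cst_continuous. Qed.

Lemma locally_bounded_sum (I : Type) (r : seq I) (g : I -> 'rV[R]_n -> R) :
  (forall k, locally_bounded (g k)) ->
  locally_bounded (fun x => \sum_(k <- r) g k x).
Proof.
move=> hg; elim: r => [|k r IH].
  by under [X in locally_bounded X]funext do rewrite big_nil;
    exact: locally_bounded_cst.
by under [X in locally_bounded X]funext do rewrite big_cons;
  exact: locally_boundedD.
Qed.

Lemma compactly_supportedMl g h : compactly_supported g ->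
  compactly_supported (fun x => g x * h x).
Proof. by move=> [r gr]; exists r => x /gr ->; rewrite mul0r. Qed.

Lemma compactly_supportedMr g h : compactly_supported h ->
  compactly_supported (fun x => g x * h x).
Proof. by move=> [r gr]; exists r => x /gr ->; rewrite mulr0. Qed.

Lemma compactly_supportedD g h : compactly_supported g ->
  compactly_supported h -> compactly_supported (fun x => g x + h x).
Proof.
move=> [r gr] [s hs]; exists (Num.max r s) => x.
by rewrite gt_max => /andP[/gr -> /hs ->]; rewrite addr0.
Qed.

Lemma compactly_supported_sum (I : Type) (r : seq I) (g : I -> 'rV[R]_n -> R) :
  (forall k, compactly_supported (g k)) ->
  compactly_supported (fun x => \sum_(k <- r) g k x).
Proof.
move=> hg; elim: r => [|k r IH].
  by exists 0 => x _; rewrite big_nil.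
under [X in compactly_supported X]funext do rewrite big_cons.
exact: compactly_supportedD.
Qed.

Lemma integrable_cube (C r : R) :
  (lebesgue_rV n).-integrable setT (fun x => (C * \1_(cube n r) x)%:E).
Proof.
exact: (integrableZl measurableT C
  (integrable_indic_lty (@measurable_cube R n r) (@lebesgue_rV_cube R n r))).
Qed.

Lemma locally_bounded_integrable g : locally_bounded g ->
  compactly_supported g -> (lebesgue_rV n).-integrable setT (EFin \o g).
Proof.
move=> [mg bg] [r gr].
have [C hC] := bg `|r|.
apply: (le_integrable measurableT _ _ (integrable_cube C `|r|)).
  exact/measurable_EFinP.
move=> x _ /=; rewrite lee_fin.
have [xr|rx] := leP `|x| `|r|.
  rewrite indicE mem_set ?mulr1; last by rewrite cubeE.
  exact/(le_trans (hC _ xr))/ler_norm.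
by rewrite gr ?normr0//; exact: le_lt_trans (ler_norm _) rx.
Qed.

End locally_bounded.

Lemma integral_derivative {R : realType} (p dp : R -> R) (r : R) : 0 < r ->
  (forall t : R, is_derive t (1 : R) p (dp t)) -> continuous dp ->
  (forall t, r < `|t| -> dp t = 0) ->
  (\int[lebesgue_measure]_t (dp t)%:E = (p r - p (- r))%:E)%E.
Proof.
move=> r0 hp cdp dp0.
have -> : (fun t => (dp t)%:E) = ((EFin \o dp) \_ `[- r, r]).
  apply/funext => t; rewrite /patch; case: ifPn => //.
  rewrite notin_setE/= in_itv/= -ler_norml => /negP; rewrite -ltNge.
  by move=> /dp0 ->.
rewrite -integral_mkcond EFinB.
have cp : continuous p.
  by move=> t; apply/differentiable_continuous/derivable1_diffP; case: (hp t).
apply: continuous_FTC2; first lra.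
- exact: continuous_subspaceT.
- split; first by move=> t _; case: (hp t).
  + by apply: cvg_at_right_filter; exact: cp.
  + by apply: cvg_at_left_filter; exact: cp.
- by move=> t _; rewrite derive1E; exact: derive_val.
Qed.

Lemma continuous_rV {R : realType} {n : nat} {T : topologicalType}
    (f : T -> 'rV[R]_n) (x : T) :
  (forall i, {for x, continuous (fun t => f t ord0 i)}) ->
  {for x, continuous f}.
Proof.
move=> fc; apply/cvg_ballP => e e0.
have : \forall t \near x, forall i, ball (f x ord0 i) e (f t ord0 i).
  apply: filter_forall => i; have /cvg_ballP := fc i; exact.
by apply: filterS => t h; rewrite rV_ballE.
Qed.

Section integral_of_derivative.
Context {R : realType} {n : nat}.
Implicit Types (w : 'rV[R]_n.+1 -> R) (i : 'I_n.+1).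

Lemma insert_line i t (y : 'rV[R]_n) :
  insert i t y = t *: basis i + insert i 0 y.
Proof.
apply/rowP => j; rewrite !mxE eqxx/=.
case: (unliftP i j) => [k ->|->] /=.
  by rewrite eq_sym (negPf (neq_lift _ _)) mulr0 add0r.
by rewrite eqxx mulr1 addr0.
Qed.

Lemma continuous_insert {T : topologicalType} i (f : T -> R)
    (g : T -> 'rV[R]_n) (x : T) :
  {for x, continuous f} -> {for x, continuous g} ->
  {for x, continuous (fun z => insert i (f z) (g z))}.
Proof.
move=> cf cg; apply: continuous_rV => j; rewrite /insert.
under [X in {for _, continuous X}]funext do rewrite mxE.
case: (unlift i j) => [k|] //=.
apply: (continuous_comp (g := fun y : 'rV[R]_n => y ord0 k)) => //.
exact: coord_continuous.
Qed.

Lemma col'_continuous i : continuous (col' i : 'rV[R]_n.+1 -> 'rV[R]_n).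
Proof.
move=> x; apply: continuous_rV => j.
under [X in {for _, continuous X}]funext do rewrite mxE.
exact: coord_continuous.
Qed.

Lemma support_gradient w dw r : (forall x, C1_at x w dw) ->
  (forall x, r < `|x| -> w x = 0) -> forall i x, r < `|x| -> dw i x = 0.
Proof.
move=> hw w0 i x rx; have [_ /(_ i)[dwx _]] := hw x.
have near0 : \forall y \near x, w y = (cst 0 : _ -> R) y.
  have : nbhs x (fun y : 'rV[R]_n.+1 => r < `|y|).
    have nc : `|y| @[y --> x] --> `|x| by exact: norm_continuous.
    exact: (nc _ (lt_nbhsr rx)).
  by apply: filterS => y /w0.
have := near_eq_derive (basis i) near0.
by rewrite derive_val derive_cst.
Qed.

(** Integrating along coordinate [i] first, each line contributes the difference of two values of
    [w] taken outside its support. *)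
Lemma integral_partial_eq0 w dw i : (forall x, C1_at x w dw) ->
  compactly_supported w -> (\int[lebesgue_rV n.+1]_x (dw i x)%:E = 0)%E.
Proof.
move=> hw [r w0].
have cdw : continuous (dw i) by move=> x; have [_ /(_ i)[]] := hw x.
have dw0 := support_gradient hw w0.
have idw : (lebesgue_rV n.+1).-integrable setT (EFin \o dw i).
  apply: locally_bounded_integrable; first exact: continuous_locally_bounded.
  by exists r; exact: dw0.
have [-> ifub] := integral_rV_insert i idw.
rewrite -(integral21_prod_meas1 ifub); apply: integral0_eq => y _.
rewrite /fubini_G/=.
(* [r] may be negative, hence the absolute value; adding 1 puts the endpoints strictly outside the
   support. *)
have r1 : 0 < `|r| + 1 by rewrite ltr_wpDl.
rewrite /insert_pair/=.
have far t : `|r| + 1 <= `|t| -> r < `|insert i t y|.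
  move=> rt; apply: (lt_le_trans (y := `|t|)).
    by rewrite (le_lt_trans (ler_norm r))// (lt_le_trans _ rt)// ltrDl.
  by rewrite -{1}(insert_self i t y); exact: coord_le_norm.
have hd (t : R) : is_derive t (1 : R) (fun t => w (insert i t y))
    (dw i (insert i t y)).
  have fE : (fun t => w (insert i t y)) = (fun t =>
    w (t *: basis i + insert i 0 y)).
    by apply/funext => s; rewrite insert_line.
  have [_ /(_ i)[dwx _]] := hw (insert i t y); rewrite fE.
  apply: (proj1 (@is_derive_line _ _ w (insert i 0 y) (basis i) t _)).
  have <- := insert_line i t y.
  exact: dwx.
rewrite (integral_derivative r1 hd).
- have e : `| `|r| + 1 | = `|r| + 1 by rewrite gtr0_norm.
  by rewrite !w0 ?subrr//; apply: far; rewrite ?normrN e.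
- move=> t; apply: (@continuous_comp _ _ _ (fun t => insert i t y) (dw i)).
    by apply: continuous_insert => //; exact: cst_continuous.
  exact: cdw.
- by move=> t rt; apply: dw0; exact/far/ltW.
Qed.

End integral_of_derivative.

(** * Concentration on a graph *)

Lemma Rintegral_dominated_cvg d (T : measurableType d) (R : realType)
    (mu : {measure set T -> \bar R}) (D : set T) (f_ : nat -> T -> R)
    (f g : T -> R) : measurable D ->
  (forall k, measurable_fun D (f_ k)) ->
  (forall x, D x -> f_ k x @[k --> \oo] --> f x) ->
  mu.-integrable D (EFin \o g) ->
  (forall k x, D x -> `|f_ k x| <= g x) ->
  mu.-integrable D (EFin \o f) /\
  \int[mu]_(x in D) f_ k x @[k --> \oo] --> \int[mu]_(x in D) f x.
Proof.
move=> mD mf_ f_f ig fg.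
have mf : measurable_fun D f by exact: measurable_fun_cvg mf_ f_f.
have [||||intf _ cv] := @dominated_convergence _ _ _ mu D mD
  (fun k => EFin \o f_ k) (EFin \o f) (EFin \o g) _ _ _ ig.
- by move=> k; exact/measurable_EFinP.
- exact/measurable_EFinP.
- by apply: aeW => x Dx; apply/cvg_EFin; [exact: nearW|exact: f_f].
- by apply: aeW => x k Dx; rewrite /= lee_fin; exact: fg.
split => //; apply: fine_cvg; rewrite fineK; last exact: integrable_fin_num.
exact: cv.
Qed.

Lemma continuous_integrable1 {R : realType} (p : R -> R) (r : R) :
  continuous p -> (forall t, r < `|t| -> p t = 0) ->
  lebesgue_measure.-integrable setT (EFin \o p).
Proof.
move=> cp p0.
have -> : EFin \o p = (EFin \o p) \_ `[- r, r].
  apply/funext => t; rewrite /patch; case: ifPn => //.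
  rewrite notin_setE/= in_itv/= -ler_norml => /negP; rewrite -ltNge.
  by move=> /p0 /= ->.
apply/(integrable_mkcond _ _).1; first exact: measurable_itv.
apply: continuous_compact_integrable; first exact: segment_compact.
exact: continuous_subspaceT.
Qed.

Lemma continuous_bounded1 {R : realType} (p : R -> R) (r : R) :
  continuous p -> (forall t, r < `|t| -> p t = 0) ->
  exists C, forall t, `|p t| <= C.
Proof.
move=> cp p0.
have /compact_bounded[M [_ mrt]] : compact (p @` `[- r, r]%classic).
  apply: continuous_compact; last exact: segment_compact.
  exact: continuous_subspaceT.
exists (`|M| + 1) => t; have [tr|/p0->] := leP `|t| r; last first.
  by rewrite normr0 addr_ge0.
apply: (mrt (`|M| + 1)); first by rewrite (le_lt_trans (ler_norm _))// ltrDl.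
by exists t => //=; rewrite in_itv/= -ler_norml.
Qed.

Lemma norm_le_insert {R : realType} {n : nat} (i : 'I_n.+1) (t : R)
    (y : 'rV[R]_n) : `|y| <= `|insert i t y|.
Proof.
have : cube n `|insert i t y| y.
  by move=> k /=; rewrite -ler_norml -(insert_lift i t y); exact: coord_le_norm.
by rewrite cubeE.
Qed.

Lemma continuous_id {T : topologicalType} (x : T) :
  {for x, continuous (fun y : T => y)}.
Proof. exact: cvg_id. Qed.

Lemma continuous_insertl {R : realType} {n : nat} (i : 'I_n.+1)
    (y : 'rV[R]_n) : continuous (fun t : R => insert i t y).
Proof.
move=> t; apply: continuous_insert; first exact: continuous_id.
exact: cst_continuous.
Qed.

Section concentration.
Context {R : realType} {n : nat} (i : 'I_n.+1).
Variables (kap : R -> R) (gam : 'rV[R]_n -> R) (Psi : 'rV[R]_n.+1 -> R).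
Hypotheses (ckap : continuous kap) (kap0 : forall t, 1 < `|t| -> kap t = 0).
Hypotheses (cgam : continuous gam) (cPsi : continuous Psi).
Hypothesis sPsi : compactly_supported Psi.

Let shift_insert (k : nat) (p : measurableTypeR R * 'rV[R]_n) :=
  insert i (gam p.2 + k.+1%:R^-1 * p.1) p.2.

(** The integrand in the rescaled height [p.1]: the factor k + 1 has been absorbed by the Jacobian
    of the substitution. *)
Let H (k : nat) (p : measurableTypeR R * 'rV[R]_n) : R :=
  kap p.1 * Psi (shift_insert k p).

Let measurable_H k : measurable_fun setT (H k).
Proof.
apply: measurable_funM.
  by apply: measurableT_comp measurable_fst; exact: continuous_measurable_fun.
have -> : (fun p => Psi (shift_insert k p)) = (Psi \o insert_pair i) \o
  (fun p : measurableTypeR R * 'rV[R]_n => ((gam p.2 + k.+1%:R^-1 * p.1 :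
    measurableTypeR R), p.2)) by [].
apply: measurableT_comp.
  apply: measurableT_comp; first exact: continuous_measurable_fun_rV.
  exact: measurable_insert.
apply/measurable_fun_pairP; split => //=; last exact: measurable_snd.
apply: measurable_funD; last by apply: measurable_funM => //;
  exact: measurable_fst.
apply: measurableT_comp measurable_snd; exact: continuous_measurable_fun_rV.
Qed.

(** The kernel (k + 1) kap ((k + 1) s) is an approximate multiple of the Dirac mass across the
    graph. After rescaling the height, the integrand converges pointwise and is dominated by a
    constant on a fixed bounded set. *)
Lemma concentration :
  \int[lebesgue_rV n.+1]_x (k.+1%:R * kap (k.+1%:R * (x ord0 i - gam (col' i
    x))) *
    Psi x) @[k --> \oo] -->
  (\int[lebesgue_measure]_t kap t) *
    \int[lebesgue_rV n]_y Psi (insert i (gam y) y).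
Proof.
have [r hr] := sPsi.
have [_ /(_ `|r|)[CP hCP]] := continuous_locally_bounded cPsi.
have [Ck hCk] := continuous_bounded1 ckap kap0.
pose A : set (measurableTypeR R) := [set t : R | - 1 <= t <= 1].
have mA : measurable A by rewrite /A segmentE; exact: measurable_itv.
have lA : lebesgue_measure A \is a fin_num.
  by rewrite /A segmentE lebesgue_measure_itv/=; case: ifP.
(* The bound on y is independent of k and of [gam]: inserting a coordinate does not decrease the
   norm, so [Psi] vanishes when y is outside [B]. *)
pose B : set 'rV[R]_n := cube n `|r|.
have mB : measurable B := @measurable_cube R n `|r|.
pose M := Ck * `|CP|.
pose G (p : measurableTypeR R * 'rV[R]_n) : R := M * \1_(A `*` B) p.
have iG : (lebesgue_measure \x lebesgue_rV n)%E.-integrable setT (EFin \o G).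
  have h : (lebesgue_measure \x lebesgue_rV n)%E.-integrable setT
      (EFin \o \1_(A `*` B)).
    apply: integrable_indic_lty; first exact: measurableX.
    rewrite [X in (X < _)%E]product_measure1E//; apply: lte_mul_pinfty => //.
    exact: lebesgue_rV_cube.
  exact: (integrableZl measurableT M h).
have Ck0 : 0 <= Ck by exact: le_trans (hCk 0).
have Psi_le x : `|Psi x| <= `|CP|.
  have [xr|rx] := leP `|x| `|r|; first exact/(le_trans (hCP _ xr))/ler_norm.
  by rewrite hr ?normr0//; exact: le_lt_trans (ler_norm _) rx.
have HG k p : `|H k p| <= G p.
  have G0 : 0 <= G p by rewrite mulr_ge0// mulr_ge0.
  have [p1|p1] := leP `|p.1| 1; last by rewrite /H kap0// mul0r normr0.
  have [p2|p2] := leP `|p.2| `|r|; last first.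
    rewrite /H (hr (shift_insert k p)) ?mulr0 ?normr0//.
    by rewrite (le_lt_trans (ler_norm r))// (lt_le_trans p2)// norm_le_insert.
  rewrite /G indicE mem_set ?mulr1; first by rewrite normrM ler_pM.
  by split; [rewrite /A/= -ler_norml|rewrite /B cubeE].
have iH k : (lebesgue_measure \x lebesgue_rV n)%E.-integrable setT (EFin \o H
  k).
  apply: (le_integrable measurableT _ _ iG); first exact/measurable_EFinP.
  by move=> p _ /=; rewrite lee_fin (le_trans (HG k p))// ler_norm.
pose H0 (p : measurableTypeR R * 'rV[R]_n) := kap p.1 * Psi (insert i (gam p.2)
  p.2).
have cvH0 p : H k p @[k --> \oo] --> H0 p.
  apply: cvgM; first exact: cvg_cst.
  apply: (@cvg_comp _ _ _ (fun k => shift_insert k p) Psi _ (nbhs (insert i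
    (gam p.2) p.2)));
    last exact: cPsi.
  rewrite /shift_insert.
  have h := @continuous_insertl _ _ i p.2 (gam p.2).
  have hh : gam p.2 + k.+1%:R^-1 * p.1 @[k --> \oo] --> gam p.2 + 0 * p.1.
    apply: cvgD; first exact: cvg_cst.
    by apply: cvgM; [exact: cvg_harmonic|exact: cvg_cst].
  rewrite mul0r addr0 in hh.
  exact: (cvg_comp _ _ hh h).
have [iH0 cvH] := @Rintegral_dominated_cvg _ _ _ _ setT H H0 G measurableT
  measurable_H (fun p _ => cvH0 p) iG (fun k p _ => HG k p).
pose f_ k (x : 'rV[R]_n.+1) := k.+1%:R * kap (k.+1%:R * (x ord0 i - gam (col' i
  x))) * Psi x.
have ck0 (T : topologicalType) (c : R) (x : T) : {for x, continuous (fun=> c)}.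
  exact: cst_continuous.
have ckap' (T : topologicalType) (c : R) (g : T -> R) (x : T) :
    {for x, continuous g} -> {for x, continuous (fun z => kap (c * g z))}.
  move=> cg; apply: (@continuous_comp _ _ _ (fun z => c * g z) kap);
    last exact: ckap.
  exact: (continuousM (ck0 _ c x) cg).
have cf_ k : continuous (f_ k).
  move=> x; apply: (continuousM _ (@cPsi x)); apply: (continuousM (ck0 _ _ x)).
  apply: ckap'; apply: continuousB; first exact: coord_continuous.
  by apply: continuous_comp; [exact: col'_continuous|exact: cgam].
(* Fubini along coordinate i, then the substitution t = gam y + t' / (k + 1). *)
have E1 k : \int[lebesgue_rV n.+1]_x f_ k x =
    \int[(lebesgue_measure \x lebesgue_rV n)%E]_p H k p.
  rewrite /Rintegral; congr fine.
  have if_ : (lebesgue_rV n.+1).-integrable setT (EFin \o f_ k).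
    apply: locally_bounded_integrable; first exact: continuous_locally_bounded.
    exact: compactly_supportedMr.
  have [-> ifi] := integral_rV_insert i if_.
  rewrite -(integral21_prod_meas1 ifi) -(integral21_prod_meas1 (iH k)).
  apply: eq_integral => y _; rewrite /fubini_G /=.
  pose g t := kap (k.+1%:R * (t - gam y)) * Psi (insert i t y).
  have ig : lebesgue_measure.-integrable setT (EFin \o g).
    apply: (continuous_integrable1 (r := r)) => [t|t rt]; last first.
      rewrite /g hr ?mulr0//; apply: (lt_le_trans rt).
      by rewrite -{1}(insert_self i t y); exact: coord_le_norm.
    apply: continuousM.
      apply: ckap'; exact: (continuousB (@continuous_id _ t) (ck0 _ (gam y) t)).
    apply: (@continuous_comp _ _ _ (fun t => insert i t y) Psi);
      last exact: cPsi.
    exact: continuous_insertl.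
  transitivity (\int[lebesgue_measure]_t (k.+1%:R%:E * (g t)%:E))%E.
    apply: eq_integral => t _.
    by rewrite /f_ /insert_pair/= insert_self col'_insert -mulrA EFinM.
  rewrite integralZl//.
  have e0 : 0 < k.+1%:R^-1 :> R by [].
  rewrite (@integral_affine _ (gam y) k.+1%:R^-1 _ e0 ig) muleA -EFinM mulfV//
    mul1e.
  apply: eq_integral => t _; rewrite /H /g /shift_insert /=.
  suff -> : k.+1%:R * (gam y + k.+1%:R^-1 * t - gam y) = t by [].
  by rewrite [gam y + _]addrC addrK mulrA mulfV// mul1r.
under eq_fun do rewrite E1.
have <- : \int[(lebesgue_measure \x lebesgue_rV n)%E]_p H0 p =
   (\int[lebesgue_measure]_t kap t) * \int[lebesgue_rV n]_y Psi (insert i (gam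
     y) y).
  have ikap := continuous_integrable1 ckap kap0.
  have iPsi : (lebesgue_rV n).-integrable setT
      (EFin \o (fun y => Psi (insert i (gam y) y))).
    apply: locally_bounded_integrable.
      apply: continuous_locally_bounded => y.
      apply: (@continuous_comp _ _ _ (fun y => insert i (gam y) y) Psi);
        last exact: cPsi.
      apply: continuous_insert; [exact: cgam|exact: continuous_id].
    by exists r => y ry; rewrite hr// (lt_le_trans ry)// norm_le_insert.
  rewrite -RintegralZl//; rewrite /Rintegral -(integral21_prod_meas1 iH0).
  congr fine; apply: eq_integral => y _; rewrite /fubini_G /H0 /=.
  under eq_integral do rewrite mulrC EFinM.
  rewrite integralZl// EFinM fineK; last exact: integrable_fin_num.
  by rewrite muleC.
exact: cvH.
Qed.

End concentration.

(** * Jump formula across a graph *)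

Lemma continuous_sum {R : realType} {T : topologicalType} (I : Type)
    (r : seq I) (g : I -> T -> R) (x : T) :
  (forall k, {for x, continuous (g k)}) ->
  {for x, continuous (fun z => \sum_(k <- r) g k z)}.
Proof.
move=> cg; elim: r => [|k r IH].
  by under [X in {for _, continuous X}]funext do rewrite big_nil;
    exact: cst_continuous.
by under [X in {for _, continuous X}]funext do rewrite big_cons;
  exact: (continuousD (cg k) IH).
Qed.

Section transition.
Context {R : realType} {n : nat} (i : 'I_n.+1).
Variables (gam : 'rV[R]_n -> R) (dgam : 'I_n -> 'rV[R]_n -> R).
Hypothesis hgam : forall y, C1_at y gam dgam.

Definition graph_height (x : 'rV[R]_n.+1) : R := x ord0 i - gam (col' i x).

(** The gradient of [graph_height]. It is left unnormalized because its length is the density of the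
    surface element, so that the two cancel in the flux. *)
Definition graph_conormal (j : 'I_n.+1) (y : 'rV[R]_n) : R :=
  oapp (fun k => - dgam k y) 1 (unlift i j).

Local Notation s := graph_height.

Let cgam : continuous gam. Proof. by move=> y; have [] := hgam y. Qed.

Lemma col'_basis (j : 'I_n.+1) (h : R) (x : 'rV[R]_n.+1) :
  col' i (h *: basis j + x) =
  h *: oapp (@basis R n) 0 (unlift i j) + col' i x.
Proof.
apply/rowP => k; rewrite !mxE; case: (unliftP i j) => [l ->|->] /=;
  rewrite !mxE.
  by rewrite eqxx /= (inj_eq lift_inj).
by rewrite ?eqxx /= eq_sym (negPf (neq_lift _ _)).
Qed.

Lemma C1_at_graph_height (x : 'rV[R]_n.+1) :
  C1_at x s (fun j z => graph_conormal j (col' i z)).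
Proof.
have h1 : C1_at x (fun z => gam (col' i z))
    (fun j z => oapp (fun k => dgam k (col' i z)) 0 (unlift i j)).
  have cc (g : 'rV[R]_n -> R) : continuous g ->
      {for x, continuous (fun z : 'rV[R]_n.+1 => g (col' i z))}.
    move=> cg; apply: (@continuous_comp _ _ _ (col' i) g); last exact: cg.
    exact: col'_continuous.
  split; first exact: cc.
  move=> j; split; last first.
    case: (unlift i j) => [k|] /=; last exact: cst_continuous.
    by apply: cc => y; have [_ /(_ k)[]] := hgam y.
  apply: (proj1 (@is_derive_precomp _ _ _ (col' i) gam x (basis j)
    (oapp (@basis R n) 0 (unlift i j)) _ (fun h => col'_basis j h x))).
  case: (unlift i j) => [k|] /=; last exact: is_derive0.
  by have [_ /(_ k)[]] := hgam (col' i x).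
apply: C1_at_near (C1_atD (C1_at_coord x i) (C1_atZ (-1) h1)).
  by apply: near_forall => y; rewrite mulN1r.
move=> j; apply: near_forall => y; rewrite /graph_conormal.
case: (unliftP i j) => [k ->|->] /=; last by rewrite eqxx mulr0 addr0.
by rewrite eq_sym (negPf (neq_lift _ _)) add0r mulN1r.
Qed.

Let cs : continuous s. Proof. by move=> x; have [] := C1_at_graph_height x. Qed.

Variables (p dp : R -> R) (pp pm : R).
Hypotheses (hp : forall t : R, is_derive t (1 : R) p (dp t)) (cdp : continuous
  dp).
Hypotheses (p1 : forall t, 1 <= t -> p t = pp) (pN1 : forall t : R,
  t <= -1 -> p t = pm).
Hypotheses (dp1 : forall t, 1 < `|t| -> dp t = 0) (p_le1 : forall t,
  `|p t| <= 1).
Hypotheses (p0 : forall t, `|t| < 2^-1 -> p t = 0).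
Hypotheses (dp0 : forall t, `|t| < 2^-1 -> dp t = 0).

Variables (Y : 'I_n.+1 -> 'rV[R]_n.+1 -> R).
Variables (dY : 'I_n.+1 -> 'I_n.+1 -> 'rV[R]_n.+1 -> R) (D : 'rV[R]_n.+1 -> R).
Hypotheses (cY : forall j, continuous (Y j)).
Hypotheses (sY : forall j, compactly_supported (Y j)).
Hypotheses (hY : forall x, s x != 0 -> forall j, C1_at x (Y j) (dY j)).
Hypotheses (bD : locally_bounded D) (sD : compactly_supported D).
Hypothesis (dYD : forall x, s x != 0 -> \sum_j dY j j x = D x).

Let w k j x := p (k.+1%:R * s x) * Y j x.
Let dw k j l x := p (k.+1%:R * s x) * dY j l x +
  Y j x * (dp (k.+1%:R * s x) * (k.+1%:R * graph_conormal l (col' i x))).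

(** Near a point of the graph, [p] and [dp] vanish at (k + 1) s, so the product is locally zero
    there and the values of [dY] on the graph, about which nothing is known, are multiplied by 0. *)
Let hw k j x : C1_at x (w k j) (dw k j).
Proof.
have [sx0|sx0] := eqVneq (s x) 0; last first.
  apply: C1_atM; last exact: hY.
  by apply: C1_at_comp => //; apply: C1_atZ; exact: C1_at_graph_height.
have small : \forall y \near x, `|k.+1%:R * s y| < 2^-1.
  have c : {for x, continuous (fun y => `|k.+1%:R * s y|)}.
    apply: (@continuous_comp _ _ _ (fun y => k.+1%:R * s y) Num.norm).
      apply: (continuousM _ (@cs x)); exact: cst_continuous.
    exact: norm_continuous.
  apply: (c [set t | t < 2^-1]); apply: lt_nbhsl.
  by rewrite sx0 mulr0 normr0 invr_gt0.
apply: C1_at_near (C1_at_cst x 0).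
  by apply: filterS small => y hy; rewrite /w p0// mul0r.
by move=> l; apply: filterS small => y hy; rewrite /dw p0// dp0// !mul0r mulr0
  addr0.
Qed.

Let Psi x := \sum_j graph_conormal j (col' i x) * Y j x.

Let cPsi : continuous Psi.
Proof.
have cn j : continuous (graph_conormal j).
  move=> y; rewrite /graph_conormal; case: (unlift i j) => [k|] /=.
    by apply: continuousN; have [_ /(_ k)[]] := hgam y.
  exact: cst_continuous.
move=> x; apply: continuous_sum => j; apply: continuousM; last exact: cY.
apply: (@continuous_comp _ _ _ (col' i) (graph_conormal j)); last exact: cn.
exact: col'_continuous.
Qed.

(** Only the sum [D] of the diagonal derivatives is assumed bounded near the graph; each [dY j l]
    may blow up. As |p| is at most 1, |D| dominates the volume terms uniformly in k. *)
Lemma graph_jump_formula :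
  \int[lebesgue_rV n.+1]_x
     ((if 0 < s x then pp else if s x < 0 then pm else 0) * D x) +
  (pp - pm) * \int[lebesgue_rV n]_y
     \sum_j graph_conormal j y * Y j (insert i (gam y) y) = 0.
Proof.
have sPsi : compactly_supported Psi.
  by apply: compactly_supported_sum => j; exact: compactly_supportedMr.
have iD := locally_bounded_integrable bD sD.
have cp : continuous p.
  by move=> t; apply/differentiable_continuous/derivable1_diffP; case: (hp t).
have cks k : continuous (fun x => k.+1%:R * s x).
  by move=> x; apply: (continuousM _ (@cs x)); exact: cst_continuous.
have cpk k : continuous (fun x => p (k.+1%:R * s x)).
  by move=> x; apply: (@continuous_comp _ _ _ (fun y => k.+1%:R * s y) p);
    [exact: cks|exact: cp].
have cdpk k : continuous (fun x => dp (k.+1%:R * s x)).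
  by move=> x; apply: (@continuous_comp _ _ _ (fun y => k.+1%:R * s y) dp);
    [exact: cks|exact: cdp].
pose a_ k x := p (k.+1%:R * s x) * D x.
pose b_ k x := k.+1%:R * dp (k.+1%:R * s x) * Psi x.
have ia k : (lebesgue_rV n.+1).-integrable setT (EFin \o a_ k).
  apply: locally_bounded_integrable; last exact: compactly_supportedMr.
  by apply: locally_boundedM => //; exact: continuous_locally_bounded.
have ib k : (lebesgue_rV n.+1).-integrable setT (EFin \o b_ k).
  apply: locally_bounded_integrable; last exact: compactly_supportedMr.
  apply: locally_boundedM; last exact: continuous_locally_bounded.
  apply: locally_boundedM; first exact: locally_bounded_cst.
  exact: continuous_locally_bounded.
have abE k x : \sum_j dw k j j x = a_ k x + b_ k x.
  rewrite big_split/=; congr (_ + _).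
    rewrite -mulr_sumr /a_; have [sx0|sx0] := eqVneq (s x) 0;
      last by rewrite dYD.
    by rewrite p0 ?mul0r// sx0 mulr0 normr0 invr_gt0.
  rewrite /b_ /Psi mulr_sumr; apply: eq_bigr => j _; ring.
(* For fixed k these derivatives are continuous with compact support, so the sum and the integral
   may be exchanged before k varies; no bound uniform in k is claimed for a single j. *)
have idw k j : (lebesgue_rV n.+1).-integrable setT (EFin \o dw k j j).
  have sw : compactly_supported (w k j) by exact: compactly_supportedMr.
  apply: locally_bounded_integrable.
    by apply: continuous_locally_bounded => x; have [_ /(_ j)[]] := hw k j x.
  by have [r hr] := sw; exists r; exact: (support_gradient (hw k j) hr).
have ab0 k : \int[lebesgue_rV n.+1]_x a_ k x + \int[lebesgue_rV n.+1]_x b_ k x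
  = 0.
  rewrite -RintegralD//; under eq_Rintegral do rewrite -abE.
  rewrite /Rintegral.
  have -> : (\int[lebesgue_rV n.+1]_x (\sum_j dw k j j x)%:E)%E =
      (\sum_j \int[lebesgue_rV n.+1]_x (dw k j j x)%:E)%E.
    transitivity (\int[lebesgue_rV n.+1]_x \sum_j (dw k j j x)%:E)%E.
      by apply: eq_integral => x _; rewrite sumEFin.
    by apply: integral_sum => // j; exact: idw.
  rewrite big1// => j _; apply: integral_partial_eq0; first exact: hw.
  exact: compactly_supportedMr.
pose P (t : R) := if 0 < t then pp else if t < 0 then pm else 0.
(* [a_] is the volume term, [b_] concentrates on the graph. *)
have cva : \int[lebesgue_rV n.+1]_x a_ k x @[k --> \oo] -->
    \int[lebesgue_rV n.+1]_x (P (s x) * D x).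
  have iN : (lebesgue_rV n.+1).-integrable setT (EFin \o (fun x => `|D x|)).
    exact: (integrable_norm iD).
  have ma k : measurable_fun setT (a_ k).
    by apply/measurable_EFinP; exact: measurable_int (ia k).
  apply: (Rintegral_dominated_cvg (f_ := a_) measurableT ma _ iN _).2.
  - move=> x _; apply: cvgM; last exact: cvg_cst.
    have big (t : R) : 0 < t -> \forall k \near \oo, 1 <= k.+1%:R * t.
      move=> t0; near=> k; rewrite -ler_pdivrMr//.
      have : t^-1 <= k%:R by near: k; exact: nbhs_infty_ger.
      by rewrite div1r => /le_trans; apply; rewrite ler_nat.
    apply: cvg_near_cst; rewrite /P; case: (ltrgtP (s x) 0) => [sx|sx|->].
    + have sx' : 0 < - s x by rewrite oppr_gt0.
      by apply: filterS (big _ sx') => k hk; rewrite pN1//; lra.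
    + by apply: filterS (big _ sx) => k hk; rewrite p1.
    + by apply: nearW => k; rewrite mulr0 p0// normr0 invr_gt0.
  - by move=> k x _; rewrite normrM ler_piMl.
have cvb : \int[lebesgue_rV n.+1]_x b_ k x @[k --> \oo] -->
   (pp - pm) * \int[lebesgue_rV n]_y \sum_j graph_conormal j y * Y j (insert i
     (gam y) y).
  (* The kernel is [dp], whose total mass is the jump of [p]. *)
  have := @concentration R n i dp gam Psi cdp dp1 cgam cPsi sPsi.
  have -> : \int[lebesgue_measure]_t dp t = pp - pm.
    by rewrite /Rintegral (integral_derivative ltr01 hp cdp dp1)/= p1// pN1.
  by under [X in _ * X]eq_Rintegral do rewrite /Psi col'_insert.
have cvab := cvgD cva cvb.
have E0 : (fun k => \int[lebesgue_rV n.+1]_x a_ k x) +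
    (fun k => \int[lebesgue_rV n.+1]_x b_ k x) = cst 0.
  by apply/funext => k; exact: ab0.
rewrite E0 in cvab.
have {}cvab := cvab eventually_filter.
rewrite -(cvg_lim (@Rhausdorff R) cvab); exact: lim_cst.
Unshelve. all: by end_near. Qed.

End transition.

(** * Surface measure in a chart *)

Section parametrized_measure.
Local Open Scope ereal_scope.
Context d1 d2 (S : measurableType d1) (T : measurableType d2) (R : realType).
Variables (mu : {measure set S -> \bar R}) (sigma : {measure set T -> \bar R}).
Variables (D : set T) (G : S -> T) (rho : S -> R).
Hypotheses (mD : measurable D) (mG : measurable_fun setT G).
Hypotheses (mrho : measurable_fun setT rho) (rho0 : forall y, (0 <= rho y)%R).
Hypothesis sigmaE : forall A, measurable A ->
  sigma (A `&` D) = \int[mu]_(y in G @^-1` A) (rho y)%:E.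

Import HBNNSimple.

Let mpre A : measurable A -> measurable (G @^-1` A).
Proof. by move=> mA; rewrite -[X in measurable X]setTI; exact: mG. Qed.

Let integral_indic_param A : measurable A ->
  \int[mu]_y ((\1_A (G y))%:E * (rho y)%:E) = sigma (A `&` D).
Proof.
move=> mA; rewrite sigmaE// [RHS]integral_mkcond.
apply: eq_integral => y _; rewrite /patch indicE.
have [yA|yA] := boolP (G y \in A).
  by rewrite mul1e mem_set//; rewrite inE in yA.
by rewrite mul0e memNset//; rewrite notin_setE in yA.
Qed.

Let integral_nnsfun_param (h : {nnsfun T >-> R}) :
  \int[sigma]_(x in D) (h x)%:E = \int[mu]_y ((h (G y))%:E * (rho y)%:E).
Proof.
have mh r : measurable (h @^-1` [set r]) by exact: measurable_sfunP.
have mi r : measurable_fun setT (fun y => (r * \1_(h @^-1` [set r]) (G y))%:E).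
  apply/measurable_EFinP; apply: measurable_funM => //.
  by apply: measurableT_comp mG; exact: measurable_indic.
under [LHS]eq_integral do rewrite fimfunE -fsumEFin//.
rewrite [LHS]ge0_integral_fsum//; last 2 first.
  - by move=> r; exact/measurable_EFinP/measurableT_comp.
  - by move=> n x _; rewrite EFinM nnfun_muleindic_ge0.
under [RHS]eq_integral.
  move=> y _; rewrite fimfunE -fsumEFin//.
  rewrite ge0_mule_fsuml; last by move=> r; rewrite EFinM nnfun_muleindic_ge0.
  over.
rewrite [RHS]ge0_integral_fsum//; last 2 first.
  - by move=> r; apply: emeasurable_funM => //; exact/measurable_EFinP.
  - by move=> r y _; rewrite mule_ge0 ?lee_fin//; exact: nnfun_muleindic_ge0.
apply: eq_fsbigr => r; rewrite inE => -[x _ hx].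
have r0 : (0 <= r)%R by rewrite -hx.
rewrite integralZl_indic_nnsfun// integral_indic// -integral_indic_param//.
rewrite -ge0_integralZl//.
- by apply: eq_integral => y _; rewrite EFinM muleA.
- apply: emeasurable_funM; last exact/measurable_EFinP.
  apply/measurable_EFinP.
  by apply: measurableT_comp mG; exact: measurable_indic.
- by move=> y _; rewrite mule_ge0// lee_fin.
Qed.

(** [sigmaE] is the case of indicators; simple functions follow by linearity and nonnegative ones by
    monotone convergence. *)
Lemma ge0_integral_param (g : T -> \bar R) : measurable_fun setT g ->
  (forall x, 0 <= g x) ->
  \int[sigma]_(x in D) g x = \int[mu]_y (g (G y) * (rho y)%:E).
Proof.
move=> mg g0; pose g_ := nnsfun_approx measurableT mg.
transitivity (limn (fun n => \int[sigma]_(x in D) (g_ n x)%:E)).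
  rewrite -monotone_convergence//=.
  - by apply: eq_integral => x _; apply/esym/cvg_lim => //=;
    exact: cvg_nnsfun_approx.
  - by move=> n; apply: measurable_funTS; exact/measurable_EFinP.
  - by move=> n x _; rewrite lee_fin.
  - by move=> x _ a b ab; rewrite lee_fin; exact/lefP/nd_nnsfun_approx.
rewrite (_ : (fun _ => _) = (fun n => \int[mu]_y ((g_ n (G y))%:E * (rho
  y)%:E))); last first.
  by apply/funext => n; exact: integral_nnsfun_param.
rewrite -monotone_convergence//=.
- apply: eq_integral => y _; apply/cvg_lim => //.
  by apply: cvgeZr => //; exact: cvg_nnsfun_approx.
- move=> n; apply: emeasurable_funM; last exact/measurable_EFinP.
  apply/measurable_EFinP.
  exact: measurableT_comp mG.
- by move=> n y _; rewrite mule_ge0// lee_fin.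
- by move=> y _ a b ab; apply: lee_wpmul2r; rewrite lee_fin//;
  exact/lefP/nd_nnsfun_approx.
Qed.

Lemma integral_param (g : T -> R) : measurable_fun setT g ->
  mu.-integrable setT (EFin \o (fun y => g (G y) * rho y)%R) ->
  sigma.-integrable D (EFin \o g) /\
  (\int[sigma]_(x in D) g x = \int[mu]_y (g (G y) * rho y))%R.
Proof.
move=> mg ig; have mEg : measurable_fun setT (EFin \o g) by
  exact/measurable_EFinP.
split.
  apply/integrableP; split; first exact: measurable_funTS.
  rewrite (ge0_integral_param (g := abse \o (EFin \o g))) => [||x].
  - move/integrableP : ig => [mgr]; apply: le_lt_trans;
    apply: ge0_le_integral => //.
    + by move=> y _; rewrite mule_ge0// lee_fin.
    + apply: emeasurable_funM; last exact/measurable_EFinP.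
      apply: measurableT_comp mG; exact: measurableT_comp.
    + by apply: measurableT_comp => //; exact: mgr.
    + by move=> y _ /=; rewrite lee_fin normrM (ger0_norm (rho0 y)).
  - exact: measurableT_comp.
  - exact: abse_ge0.
rewrite /Rintegral; congr fine; rewrite [LHS]integralE [RHS]integralE.
have mp := measurable_funepos mEg; have mn := measurable_funeneg mEg.
congr (_ - _).
  rewrite (ge0_integral_param mp (funepos_ge0 _)); apply: eq_integral => y _.
  rewrite !funeposE /= -!EFin_max -EFinM; congr EFin.
  by rewrite maxr_pMl// mul0r.
rewrite (ge0_integral_param mn (funeneg_ge0 _)); apply: eq_integral => y _.
rewrite !funenegE /= -!EFin_max -EFinM; congr EFin.
by rewrite maxr_pMl// mul0r mulNr.
Qed.

End parametrized_measure.

Lemma boundary_measurable {R : realType} {n : nat} (A : set 'rV[R]_n) :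
  measurable (boundary A).
Proof.
apply: measurableD; last exact: (open_measurable_rV (@open_interior _ A)).
rewrite -[closure A]setCK; apply: measurableC; apply: open_measurable_rV.
by apply: closed_openC; exact: closed_closure.
Qed.

(** * The boundary, the sign and the surface integral in one chart *)

Section chart.
Context {R : realType} {n : nat}.
Variables (Theta U : set 'rV[R]_n.+1) (i : 'I_n.+1) (b : bool).
Variable gam : 'rV[R]_n -> R.
Hypotheses (oT : open Theta) (hch : graph_chart Theta U i b gam).

Local Notation s := (graph_height i gam).
Local Notation dgam := (fun k => partial k gam).

Lemma chart_C1 y : C1_at y gam dgam.
Proof. by case: hch => _ sg _; exact: (Ck1_C1_at (sg 1)). Qed.

Lemma chart_continuous : continuous gam.
Proof. by move=> y; have [] := chart_C1 y. Qed.

Lemma graph_height_continuous : continuous s.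
Proof. by move=> x; have [] := C1_at_graph_height i chart_C1 x. Qed.

Lemma graph_height_insert y : s (insert i (gam y) y) = 0.
Proof. by rewrite /graph_height insert_self col'_insert subrr. Qed.

(** Where the signed height is nonzero, [Theta] is locally everything or nothing. Where it is zero,
    x is outside [Theta], but points of [Theta] are reached by moving along coordinate [i]. *)
Lemma boundary_chart x : U x -> boundary Theta x <-> s x = 0.
Proof.
case: hch => oU sg UT Ux.
have sgn0 (t : R) : ((-1) ^+ b * t == 0) = (t == 0).
  by rewrite mulf_eq0 signr_eq0.
split=> [[clx nintx]|sx0].
  apply/eqP; rewrite -sgn0; case: (ltrgtP ((-1) ^+ b * s x) 0) => // sx.
    by exfalso; apply: nintx; apply: open_nbhs_nbhs; split => //; exact/UT.
  have : nbhs x (U `&` (fun y => 0 < (-1) ^+ b * s y)).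
    apply: filterI; first exact: open_nbhs_nbhs.
    have c : {for x, continuous (fun y => (-1) ^+ b * s y)}.
      apply: (continuousM _ (@graph_height_continuous x));
        exact: cst_continuous.
    exact: (c _ (lt_nbhsr sx)).
  move=> /clx[y [Ty [Uy sy]]]; have := (UT _ Uy).1 Ty.
  by rewrite ltNge ltW.
split; last first.
  move=> /interior_subset /(UT _ Ux).1.
  by rewrite -/(s x) sx0 mulr0 ltxx.
move=> B Bx.
have line0 : 0 *: basis i + x = x by rewrite scale0r add0r.
have cl : {for (0 : R), continuous (fun t : R => t *: basis i + x)}.
  have -> : (fun t : R => t *: basis i + x) =
      (fun t => insert i (t + x ord0 i) (col' i x)).
    apply/funext => t; rewrite -[in LHS](insert_col' i x) [in LHS]insert_line.
    by rewrite [RHS]insert_line addrA -scalerDl.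
  apply: continuous_insert; last exact: cst_continuous.
  apply: continuousD; [exact: continuous_id|exact: cst_continuous].
have nB : nbhs (0 : R) (fun t : R => (B `&` U) (t *: basis i + x)).
  apply: cl; rewrite line0; apply: filterI => //; exact: open_nbhs_nbhs.
have /nbhs_ballP[e /= e0 he] := nB.
(* The sign is chosen so that (-1)^b t = - e / 2 is negative, that is, the move goes into [Theta]
   whichever side of the graph it occupies. *)
pose t : R := - ((-1) ^+ b * (e / 2)).
have tB : ball (0 : R) e t.
  rewrite /ball/= sub0r normrN /t normrN normrM normrX normrN1 expr1n mul1r.
  by rewrite ger0_norm ?divr_ge0 ?ltW//; lra.
have [Bt Ut] := he _ tB.
exists (t *: basis i + x); split => //; apply/(UT _ Ut).
have -> : (t *: basis i + x) ord0 i - gam (col' i (t *: basis i + x)) = t + s x.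
  rewrite col'_basis unlift_none scaler0 add0r !mxE !eqxx mulr1.
  by rewrite /graph_height addrA.
by rewrite sx0 addr0 /t mulrN mulrA -expr2 sqrr_sign mul1r oppr_lt0 divr_gt0.
Qed.

Lemma chart_Qsign x : U x -> s x != 0 ->
  Qsign Theta x = - ((-1) ^+ b * Num.sg (s x)).
Proof.
case: hch => _ _ UT Ux sx; rewrite /Qsign.
have := UT _ Ux; rewrite -/(s x).
have [xT h|xT h] := boolP (x \in Theta).
  rewrite inE in xT; have := h.1 xT.
  case: (b); rewrite ?expr1 ?expr0 ?mulN1r ?mul1r ?oppr_lt0 => sx'.
    by rewrite gtr0_sg// opprK.
  by rewrite ltr0_sg// opprK.
rewrite notin_setE in xT.
have : ~ ((-1) ^+ b * s x < 0) by move/h.2.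
case: (b); rewrite ?expr1 ?expr0 ?mulN1r ?mul1r ?oppr_lt0 => /negP;
  rewrite -leNgt => sx'.
  by rewrite ltr0_sg ?opprK// lt_neqAle sx.
by rewrite gtr0_sg// lt_neqAle eq_sym sx.
Qed.

(** By Fubini's theorem: every line in direction [i] meets the graph in a single point. *)
Lemma graph_null : lebesgue_rV n.+1 [set x | s x = 0] = 0%E.
Proof.
have mA : measurable [set x | s x = 0].
  rewrite (_ : [set _ | _] = s @^-1` [set 0]) //.
  rewrite -[X in measurable X]setTI.
  by apply: (continuous_measurable_fun_rV (D := setT) graph_height_continuous).
rewrite (lebesgue_rV_insert i mA) /pushforward.
set B := _ @^-1` _.
have mB : measurable B.
  by rewrite /B -[X in measurable X]setTI; exact: measurable_insert.
have -> : (lebesgue_measure \x lebesgue_rV n)%E B =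
    (\int[lebesgue_measure \x lebesgue_rV n]_p (\1_B p)%:E)%E.
  by rewrite integral_indic// setIT.
rewrite fubini_tonelli2//=.
  apply: integral0_eq => y _; rewrite /fubini_G.
  transitivity (\int[lebesgue_measure]_t (\1_[set gam y] t)%:E)%E.
    apply: eq_integral => t _; congr EFin; rewrite !indicE;
      congr (nat_of_bool _)%:R.
    apply/idP/idP; rewrite !inE /B /insert_pair/= /graph_height insert_self
      col'_insert.
      by move/eqP; rewrite subr_eq0 => /eqP.
    by move=> ->; rewrite subrr.
  by rewrite integral_indic// setIT; exact: lebesgue_measure_set1.
by apply/measurable_EFinP; exact: measurable_indic.
Qed.

Variables (nu : 'rV[R]_n.+1 -> 'rV[R]_n.+1).
Hypothesis hnu : exterior_unit_normal Theta nu.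
Variable sigma : {measure set 'rV[R]_n.+1 -> \bar R}.
Hypothesis hsigma : surface_measure Theta sigma.

Let G y := insert i (gam y) y.
Let rho y : R := Num.sqrt (1 + enorm (grad gam y) ^+ 2).

Let rho_gt0 y : 0 < rho y.
Proof. by rewrite sqrtr_gt0 ltr_wpDr// sqr_ge0. Qed.

Let crho : continuous rho.
Proof.
move=> y.
have cd k : {for y, continuous (fun z => partial k gam z)}.
  by have [_ /(_ k)[]] := chart_C1 y.
have cdot : {for y, continuous (fun z => dotp (grad gam z) (grad gam z))}.
  apply: continuous_sum => k.
  by under [X in {for _, continuous X}]funext do rewrite !mxE;
    exact: continuousM.
have csq (g : 'rV[R]_n -> R) : {for y, continuous g} ->
    {for y, continuous (fun z => Num.sqrt (g z))}.
  move=> cg; apply: (@continuous_comp _ _ _ g Num.sqrt) => //;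
    exact: sqrt_continuous.
apply: (csq (fun z => 1 + enorm (grad gam z) ^+ 2)).
apply: continuousD; first exact: cst_continuous.
by apply: continuousM; exact: csq.
Qed.

Let cG : continuous G.
Proof.
by move=> y; apply: continuous_insert; [exact: chart_continuous|exact:
  continuous_id].
Qed.

Let mG : measurable_fun setT G.
Proof.
rewrite (_ : G = insert_pair i \o (fun y => (gam y : measurableTypeR R, y))) //.
apply: measurableT_comp; first exact: measurable_insert.
apply/measurable_fun_pairP; split; last exact: measurable_id.
exact: (continuous_measurable_fun_rV (D := setT) chart_continuous).
Qed.

(** [gam] is defined on the whole hyperplane, but its graph describes the boundary only inside [U];
    the indicator discards the other parameters. *)
Let rhoU y := rho y * \1_U (G y).

Let chart_surface_measure A : measurable A ->
  sigma (A `&` (boundary Theta `&` U)) =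
  (\int[lebesgue_rV n]_(y in G @^-1` A) (rhoU y)%:E)%E.
Proof.
have oU : open U by case: hch.
have mU := open_measurable_rV oU.
move=> mA; rewrite (_ : A `&` _ = (A `&` U) `&` boundary Theta); last first.
  by rewrite [boundary _ `&` U]setIC setIA.
rewrite (hsigma hch) => [||x []//]; last exact: measurableI.
rewrite integral_mkcond [RHS]integral_mkcond; apply: eq_integral => y _.
have -> : col' i @` (A `&` U `&` boundary Theta) = G @^-1` (A `&` U).
  apply/seteqP; split => [_ [x [[Ax Ux] bx] <-]|z [Az Uz]].
    suff e : G (col' i x) = x by split; rewrite /= e.
    have := (boundary_chart Ux).1 bx; rewrite /G /graph_height => /eqP.
    by rewrite subr_eq0 => /eqP <-; rewrite insert_col'.
  exists (G z); last exact: col'_insert.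
  by split => //; apply/(boundary_chart Uz); exact: graph_height_insert.
rewrite /patch /rhoU indicE.
have [yA|yA] := boolP (G y \in A); have [yU|yU] := boolP (G y \in U).
- by rewrite !mem_set /= ?mulr1//; move: yA yU; rewrite !inE.
- rewrite mulr0 if_same memNset// => -[_].
  by rewrite notin_setE in yU.
- by rewrite !memNset// => [|[]]; rewrite notin_setE in yA.
- by rewrite !memNset// => [|[]]; rewrite notin_setE in yA.
Qed.

(** The unit normal is (-1)^b times the conormal divided by [rho], and the surface element is [rho]
    dy: the square roots cancel, leaving the graph integral of the jump formula with the sign
    (-1)^b. *)
Lemma chart_boundary_integral (g : 'rV[R]_n.+1 -> R)
    (Y : 'I_n.+1 -> 'rV[R]_n.+1 -> R) :
  (forall j, continuous (Y j)) -> (forall j, compactly_supported (Y j)) ->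
  (forall j x, ~ U x -> Y j x = 0) ->
  (forall z, boundary Theta z -> g z = \sum_j Y j z * nu z ord0 j) ->
  sigma.-integrable (boundary Theta) (EFin \o g) /\
  \int[sigma]_(z in boundary Theta) g z = (-1) ^+ b *
    \int[lebesgue_rV n]_y \sum_j graph_conormal i dgam j y * Y j (insert i (gam
      y) y).
Proof.
move=> cY sY Y0 gE.
have oU : open U by case: hch.
have mU := open_measurable_rV oU.
have mbd := boundary_measurable Theta.
have ccol := @col'_continuous R n i.
have cn j : continuous (graph_conormal i dgam j).
  move=> y; rewrite /graph_conormal; case: (unlift i j) => [k|] /=.
    by apply: continuousN; have [_ /(_ k)[]] := chart_C1 y.
  exact: cst_continuous.
(* [nu] is prescribed on the boundary only, so [g] need not be measurable on the whole space. [gt]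
   extends its boundary values continuously, through the chart formula for the normal. *)
pose gt z := \sum_j Y j z * ((-1) ^+ b / rho (col' i z) * graph_conormal i dgam
  j (col' i z)).
have cgt : continuous gt.
  move=> x; apply: continuous_sum => j; apply: (continuousM (@cY j x)).
  apply: continuousM.
    apply: continuousM; first exact: cst_continuous.
    apply: (@continuousV _ _ (fun z => rho (col' i z)));
      first by rewrite gt_eqF.
    apply: (@continuous_comp _ _ _ (col' i) rho); [exact: ccol|exact: crho].
  apply: (@continuous_comp _ _ _ (col' i) (graph_conormal i dgam j));
    [exact: ccol|exact: cn].
have ggt z : boundary Theta z -> g z = gt z.
  move=> bz; rewrite gE//; apply: eq_bigr => j _.
  have [Uz|nUz] := pselect (U z); last by rewrite Y0// !mul0r.
  by congr (_ * _); rewrite (hnu hch Uz bz) !mxE.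
have gt0 z : ~ U z -> gt z = 0.
  by move=> nUz; rewrite /gt big1// => j _; rewrite Y0// mul0r.
pose h y := (-1) ^+ b * \sum_j graph_conormal i dgam j y * Y j (G y).
have cS : continuous (fun y => \sum_j graph_conormal i dgam j y * Y j (G y)).
  move=> y; apply: continuous_sum => j; apply: (continuousM (@cn j y)).
  by apply: (@continuous_comp _ _ _ G (Y j)); [exact: cG|exact: cY].
have iS : (lebesgue_rV n).-integrable setT
    (EFin \o (fun y => \sum_j graph_conormal i dgam j y * Y j (G y))).
  apply: locally_bounded_integrable; first exact: continuous_locally_bounded.
  apply: compactly_supported_sum => j; apply: compactly_supportedMr.
  have [r hr] := sY j; exists r => y ry.
  by apply: hr; apply: (lt_le_trans ry); exact: norm_le_insert.
have hE y : gt (G y) * rhoU y = h y.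
  rewrite /gt /rhoU /h indicE; have [yU|yU] := boolP (G y \in U).
    rewrite mulr1 mulr_sumr mulr_suml; apply: eq_bigr => j _.
    rewrite col'_insert; have := rho_gt0 y; move: (rho y) => r r0.
    by field; rewrite gt_eqF.
  rewrite mulr0 mulr0 big1 ?mulr0// => j _; rewrite Y0 ?mulr0//.
  by rewrite notin_setE in yU.
have mgt : measurable_fun setT gt by exact: continuous_measurable_fun_rV.
have mrhoU : measurable_fun setT rhoU.
  apply: measurable_funM; first exact: continuous_measurable_fun_rV.
  by apply: measurableT_comp mG; exact: measurable_indic.
have rhoU0 y : 0 <= rhoU y by rewrite mulr_ge0// ltW.
have [] := integral_param (measurableI _ _ mbd mU) mG mrhoU rhoU0
  chart_surface_measure mgt.
  rewrite (_ : (fun _ => _) = h); last by apply/funext => y; exact: hE.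
  exact: (integrableZl measurableT _ iS).
move=> ig Ig.
have patchE : (EFin \o g) \_ (boundary Theta) =
    (EFin \o gt) \_ (boundary Theta `&` U).
  apply/funext => z; rewrite /patch in_setI.
  have [zb|//] := boolP (z \in boundary Theta).
  have [zU|zU] /= := boolP (z \in U); rewrite ggt//; try by rewrite inE in zb.
  by rewrite gt0//; rewrite notin_setE in zU.
have -> : \int[sigma]_(z in boundary Theta) g z =
    \int[sigma]_(z in boundary Theta `&` U) gt z.
  by rewrite /Rintegral; congr fine; rewrite integral_mkcond
    [RHS]integral_mkcond patchE.
split.
  apply/(integrable_mkcond _ mbd).2; rewrite patchE.
  by apply/(integrable_mkcond _ _).1 => //; exact: measurableI.
rewrite Ig; under eq_Rintegral do rewrite hE.
by rewrite /h RintegralZl.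
Qed.

End chart.

(** * Symmetry of second derivatives *)

Section schwarz.
Context {R : realType} {n : nat}.
Implicit Types (g : 'rV[R]_n -> R) (x z : 'rV[R]_n).

(** Half of [e] for each displacement, because they add up when [i] and [j] coincide. *)
Lemma norm_basis_line (i j : 'I_n) (s t : R) x (e : R) :
  `|s| < e / 2 -> `|t| < e / 2 -> ball x e (t *: basis j + (s *: basis i + x)).
Proof.
move=> se te.
have e0 : 0 < e by have := le_lt_trans (normr_ge0 s) se; lra.
rewrite rV_ballE// => k /=; rewrite /ball/= !mxE !eqxx/=.
have d (c : bool) : `|c%:R| <= 1 :> R by case: c; rewrite ?normr1 ?normr0.
set c1 := (_ == j)%:R; set c2 := (_ == i)%:R.
have -> : x ord0 k - (t * c1 + (s * c2 + x ord0 k)) =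
  - (t * c1 + s * c2) by ring.
rewrite normrN (le_lt_trans (ler_normD _ _))// !normrM [ltRHS](splitr e).
by apply: ltrD; [apply: le_lt_trans te|apply: le_lt_trans se];
  by rewrite ler_piMr ?d.
Qed.

(** Two applications of the mean value theorem: to the increment of [g] in direction j as a function
    of the displacement s along i, then to [g1] along j. *)
Lemma second_difference g g1 g2 (i j : 'I_n) x (e h : R) :
  0 < h < e / 2 ->
  (forall z, ball x e z -> is_derive z (basis i) g (g1 z)) ->
  (forall z, ball x e z -> is_derive z (basis j) g1 (g2 z)) ->
  exists2 z, ball x e z &
    g (h *: basis j + (h *: basis i + x)) - g (h *: basis j + x)
    - g (h *: basis i + x) + g x = h * h * g2 z.
Proof.
move=> /andP[h0 he] hg hg1.
have small (s : R) : s \in `[0, h] -> `|s| < e / 2.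
  by rewrite in_itv/= => /andP[s0 sh]; rewrite ger0_norm// (le_lt_trans sh).
have h0h : h \in `[0, h] by rewrite in_itv/= lexx ltW.
have z0h : 0 \in `[0, h] by rewrite in_itv/= lexx ltW.
pose phi s := g (s *: basis i + (h *: basis j + x)) - g (s *: basis i + x).
pose dphi s := g1 (s *: basis i + (h *: basis j + x)) - g1 (s *: basis i + x).
have hphi s : s \in `[0, h] -> is_derive s (1 : R) phi (dphi s).
  move=> sh; apply: is_deriveB.
    apply: (proj1 (@is_derive_line _ _ g (h *: basis j + x) (basis i) s _)).
    by apply: hg; apply: norm_basis_line; exact: small.
  apply: (proj1 (@is_derive_line _ _ g x (basis i) s _)).
  apply: hg; have := @norm_basis_line j i 0 s x e; rewrite scale0r add0r; apply.
    exact: small.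
  exact: small.
have hphi' s : s \in `]0, h[ -> is_derive s (1 : R) phi (dphi s).
  by move=> sh; apply: hphi; exact: subset_itv_oo_cc.
have cphi : {within `[0, h], continuous phi}.
  by apply: derivable_within_continuous => s sh; case: (hphi _ sh).
have [s1 s1h E1] := MVT h0 hphi' cphi.
have s1h' : s1 \in `[0, h] by exact: subset_itv_oo_cc.
pose psi t := g1 (t *: basis j + (s1 *: basis i + x)).
pose dpsi t := g2 (t *: basis j + (s1 *: basis i + x)).
have hpsi t : t \in `[0, h] -> is_derive t (1 : R) psi (dpsi t).
  move=> th; apply: (proj1 (@is_derive_line _ _ g1 (s1 *: basis i + x) (basis
    j) t _)).
  by apply: hg1; apply: norm_basis_line; exact: small.
have hpsi' s : s \in `]0, h[ -> is_derive s (1 : R) psi (dpsi s).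
  by move=> sh; apply: hpsi; exact: subset_itv_oo_cc.
have cpsi : {within `[0, h], continuous psi}.
  by apply: derivable_within_continuous => s sh; case: (hpsi _ sh).
have [t1 t1h E2] := MVT h0 hpsi' cpsi.
exists (t1 *: basis j + (s1 *: basis i + x)).
  by apply: norm_basis_line; apply: small => //; exact: subset_itv_oo_cc.
rewrite !subr0 in E1 E2.
have E3 : dphi s1 = psi h - psi 0.
  rewrite /dphi /psi scale0r add0r addrCA; congr (g1 _ - _).
rewrite E3 E2 in E1.
have -> : h * h * g2 (t1 *: basis j + (s1 *: basis i + x)) = phi h - phi 0.
  by rewrite E1 /dpsi; ring.
rewrite /phi !scale0r !add0r [h *: basis i + (h *: basis j + x)]addrCA; ring.
Qed.

(** The second difference is symmetric in i and j, so the two mixed derivatives take a common value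
    p = q at two points near x. If they differed at x, continuity would put this value at distance
    less than half of |a - b| from both a and b. *)
Lemma schwarz (D : set 'rV[R]_n) g x (i j : 'I_n) : open D -> Ck 2 D g -> D x ->
  partial j (partial i g) x = partial i (partial j g) x.
Proof.
move=> oD gD Dx.
have C1 z : D z -> forall k, is_derive z (basis k) g (partial k g z).
  by move=> Dz k; apply/derivableP; exact: (gD.1 [::]).
have C2 z : D z -> forall k l, is_derive z (basis l) (partial k g) (partial l
  (partial k g) z).
  by move=> Dz k l; apply/derivableP; exact: (gD.1 [:: k]).
have cc k l : {for x, continuous (partial l (partial k g))} by exact: (gD.2 [::
  l; k]).
apply/eqP/negPn/negP => ab.
set a := partial j (partial i g) x in ab *; set b := partial i (partial j g) x
  in ab *.
have d0 : 0 < `|a - b| / 2 by rewrite divr_gt0// normr_gt0 subr_eq0.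
have na : nbhs x (fun z => D z /\ (`|a - partial j (partial i g) z| < `|a - b|
  / 2 /\
    `|b - partial i (partial j g) z| < `|a - b| / 2)).
  apply: filterI; first exact: open_nbhs_nbhs.
  by apply: filterI; [have /cvgrPdist_lt := cc i j|have /cvgrPdist_lt := cc j
    i]; exact.
have /nbhs_ballP[e /= e0 he] := na.
have h4 : 0 < e / 4 < e / 2 by apply/andP; split; [rewrite divr_gt0|lra].
have [z1 bz1 E1] := second_difference h4 (fun z bz => C1 z (he z bz).1 i)
  (fun z bz => C2 z (he z bz).1 i j).
have [z2 bz2 E2] := second_difference h4 (fun z bz => C1 z (he z bz).1 j)
  (fun z bz => C2 z (he z bz).1 j i).
have [_ [A1 _]] := he _ bz1; have [_ [_ A2]] := he _ bz2.
have h0 : e / 4 * (e / 4) != 0 by rewrite mulf_neq0// gt_eqF//; case/andP: h4.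
move: (partial j (partial i g) z1) (partial i (partial j g) z2) A1 A2 E1 E2.
move=> p q A1 A2 E1; rewrite addrCA => E2.
have pq : p = q.
  apply: (mulfI h0); apply: etrans (esym E1) _; apply: etrans E2.
  by congr (_ + _); rewrite addrAC.
rewrite pq in A1; rewrite distrC in A2.
have := le_lt_trans (ler_distD q a b) (ltrD A1 A2).
by rewrite -splitr ltxx.
Qed.

End schwarz.

(** * The primitive of the nonlinearity *)

Lemma is_derive_primitive0 {R : realType} (f : R -> R) (w : R) : continuous f ->
  is_derive w (1 : R) (primitive0 f) (f w).
Proof.
move=> cf; pose a : R := `|w| + 1.
have wa : `|w| < a by rewrite ltrDl.
have /andP[aw wa'] : - a < w < a by rewrite -ltr_norml.
have a0 : 0 < a by rewrite ltr_wpDl.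
have intf (c d : R) : lebesgue_measure.-integrable `[c, d] (EFin \o f).
  apply: continuous_compact_integrable; first exact: segment_compact.
  exact: continuous_subspaceT.
(* The base point - a lies to the left of both 0 and w, so near w the two cases of [primitive0]
   become the single formula H z - H 0. *)
pose H (z : R) := \int[lebesgue_measure]_(t in `[- a, z]) f t.
have [dH H1] : derivable H w 1 /\ derive1 H w = f w.
  apply: (continuous_FTC1_closed (u := a)) => //; exact: cf.
have hH : is_derive w (1 : R) (fun z => H z - H 0) (f w).
  rewrite -[f w]subr0; apply: is_deriveB.
  exact: (DeriveDef dH (etrans (esym (derive1E H w)) H1)).
apply: near_eq_is_derive hH; near=> z.
have /andP[az za] : - a < z < a.
  by apply/andP; split; near: z; [exact: lt_nbhsr|exact: lt_nbhsl].
have split_int (c d : R) : - a <= c <= d -> H d - H c =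
    \int[lebesgue_measure]_(t in `[c, d]) f t.
  move=> /andP[ac cd]; rewrite /H Rintegral_itvB ?bnd_simp//.
  rewrite Rintegral_itv_obnd_cbnd//.
  by apply: integrableS (intf c d) => //; apply: subset_itvr; rewrite bnd_simp.
rewrite /primitive0; case: (leP 0 z) => z0.
  by rewrite split_int// z0 andbT oppr_le0 ltW.
by rewrite -split_int ?opprB// (ltW az) ltW.
Unshelve. all: by end_near. Qed.

(** * The jump formula with prescribed constants on the two sides *)

Section graph_jump.
Context {R : realType} {n : nat} (i : 'I_n.+1).
Variables (gam : 'rV[R]_n -> R) (dgam : 'I_n -> 'rV[R]_n -> R).
Hypothesis hgam : forall y, C1_at y gam dgam.
Local Notation s := (graph_height i gam).

(** The pointwise limit of p ((k + 1) t); the value 0 at t = 0 is p 0. *)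
Definition side_value (pp pm t : R) := if 0 < t then pp else if t < 0 then pm
  else 0.

Let cs : continuous s.
Proof. by move=> x; have [] := C1_at_graph_height i hgam x. Qed.

Lemma locally_bounded_side_value (pp pm : R) :
  locally_bounded (fun x => side_value pp pm (s x)).
Proof.
have ms : measurable_fun setT s by exact: continuous_measurable_fun_rV.
split; last first.
  move=> r; exists (`|pp| + `|pm|) => x _; rewrite /side_value.
  case: ifP => _; first by rewrite lerDl.
  by case: ifP => _; rewrite ?lerDr// normr0 addr_ge0.
apply: measurable_fun_ifT => //.
  by apply: measurable_fun_ltr.
by apply: measurable_fun_ifT => //; apply: measurable_fun_ltr.
Qed.

Lemma graph_jump (pp pm : R) (Y : 'I_n.+1 -> 'rV[R]_n.+1 -> R)
    (dY : 'I_n.+1 -> 'I_n.+1 -> 'rV[R]_n.+1 -> R) (D : 'rV[R]_n.+1 -> R) :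
  `|pp| <= 1 -> `|pm| <= 1 ->
  (forall j, continuous (Y j)) -> (forall j, compactly_supported (Y j)) ->
  (forall x, s x != 0 -> forall j, C1_at x (Y j) (dY j)) ->
  locally_bounded D -> compactly_supported D ->
  (forall x, s x != 0 -> \sum_j dY j j x = D x) ->
  \int[lebesgue_rV n.+1]_x (side_value pp pm (s x) * D x) +
  (pp - pm) * \int[lebesgue_rV n]_y
     \sum_j graph_conormal i dgam j y * Y j (insert i (gam y) y) = 0.
Proof.
move=> pp1 pm1 cY sY hY bD sD dYD.
(* The first step rises between 1/2 and 1, the second is its mirror image: at most one of them is
   nonzero at a given t, whence the bound |p| <= 1, and both vanish for |t| <= 1/2. *)
pose p t : R := pp * step (2 * t + -1) + pm * step (-2 * t + -1).
pose dp t : R := pp * (2 * dstep (2 * t + -1)) + pm * (-2 * dstep (-2 * t +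
  -1)).
have hp (t : R) : is_derive t (1 : R) p (dp t).
  have h1 := @is_derive_affine _ step 2 (-1) t _ (is_derive_step _).
  have h2 := @is_derive_affine _ step (-2) (-1) t _ (is_derive_step _).
  exact: (is_deriveD (is_deriveZ pp h1) (is_deriveZ pm h2)).
have cdp : continuous dp.
  have ck (c t : R) : {for t, continuous (fun=> c : R)} by exact:
    cst_continuous.
  have ca (a t : R) : {for t, continuous (fun t : R => dstep (a * t + -1))}.
    apply: (@continuous_comp _ _ _ (fun t : R => a * t + -1) dstep);
      last exact: dstep_continuous.
    exact: (continuousD (continuousM (ck a t) (@continuous_id _ t)) (ck (-1)
      t)).
  move=> t; exact: (continuousD (continuousM (ck pp t) (continuousM (ck 2 t)
    (ca 2 t)))
    (continuousM (ck pm t) (continuousM (ck (-2) t) (ca (-2) t)))).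
apply: (@graph_jump_formula R n i gam dgam hgam p dp pp pm hp cdp _ _ _ _ _ _
  Y dY D cY sY hY bD sD dYD).
- by move=> t t1; rewrite /p step_ge1 ?step_le0; [ring|lra|lra].
- by move=> t t1; rewrite /p [step (2 * _ + _)]step_le0 ?step_ge1;
  [ring|lra|lra].
- move=> t; rewrite ltr_normr => /orP[] t1; rewrite /dp.
    by rewrite dstep_ge1 ?dstep_le0; [ring|lra|lra].
  by rewrite [dstep (2 * _ + _)]dstep_le0 ?dstep_ge1; [ring|lra|lra].
- move=> t; rewrite /p; have [t0|t0] := leP 0 t.
    rewrite [step (-2 * _ + _)]step_le0; last by lra.
    have /andP[a0 a1] := step_ge0_le1 (2 * t + -1).
    by rewrite mulr0 addr0 normrM mulr_ile1// ger0_norm.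
  rewrite [step (2 * _ + _)]step_le0; last by lra.
  have /andP[a0 a1] := step_ge0_le1 (-2 * t + -1).
  by rewrite mulr0 add0r normrM mulr_ile1// ger0_norm.
- move=> t; rewrite ltr_norml => /andP[t1 t2]; rewrite /p.
  by rewrite !step_le0; [ring|lra|lra].
- move=> t; rewrite ltr_norml => /andP[t1 t2]; rewrite /dp.
  by rewrite !dstep_le0; [ring|lra|lra].
Qed.

End graph_jump.

(** * The stress field *)

Section fields.
Context {R : realType} {n : nat}.
Variables (Theta : set 'rV[R]_n) (f : R -> R) (u : 'rV[R]_n -> R).
Implicit Types (x : 'rV[R]_n).

Definition grad_sq x : R := \sum_j partial j u x * partial j u x.

Definition radial_derivative x : R := \sum_j x ord0 j * partial j u x.

Definition stress (j : 'I_n) x : R :=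
  radial_derivative x * partial j u x - 2^-1 * (grad_sq x * x ord0 j).

(** The divergence of [stress] after the Laplacian has been replaced by means of the equation: only
    u and its first derivatives remain, so it makes sense and is locally bounded across the
    boundary. *)
Definition div_stress x : R :=
  (1 - n%:R / 2) * grad_sq x - Qsign Theta x * f (u x) * radial_derivative x.

(** The divergence of [pohozaev_flux] off the boundary, in which the two terms containing f (u) x .
    grad u have cancelled. *)
Definition pohozaev_density x : R :=
  (1 - n%:R / 2) * grad_sq x + n%:R * (Qsign Theta x * primitive0 f (u x)).

Definition pohozaev_flux (j : 'I_n) x : R :=
  stress j x + Qsign Theta x * (primitive0 f (u x) * x ord0 j).

Hypotheses (hTheta : open Theta) (cf : continuous f).
Hypotheses (hu1 : Ck 1 setT u) (hu2 : Ck 2 Theta u) (hu2' : Ck 2 (~` closure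
  Theta) u).
Hypothesis hsol : forall x, ~ boundary Theta x ->
  - laplacian u x = Qsign Theta x * f (u x).

Lemma off_boundary x : ~ boundary Theta x -> Theta x \/ (~` closure Theta) x.
Proof.
move=> nb; have [cx|] := pselect (closure Theta x); last by right.
left; apply: interior_subset; apply: contrapT => ni; exact: nb.
Qed.

Let cu : continuous u. Proof. by move=> x; have [] := Ck1_C1_at hu1 (x := x) I.
  Qed.

Let cdu j : continuous (partial j u).
Proof. by move=> x; have [_ /(_ j)[]] := Ck1_C1_at hu1 (x := x) I. Qed.

Lemma C1_at_partial x : ~ boundary Theta x -> forall j,
  C1_at x (partial j u) (fun l => partial l (partial j u)).
Proof.
by move=> /off_boundary[Tx|Tx] j; [exact: (Ck2_C1_at _ hu2)|exact: (Ck2_C1_at _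
  hu2')].
Qed.

Lemma partialC x : ~ boundary Theta x -> forall i j,
  partial i (partial j u) x = partial j (partial i u) x.
Proof.
move=> /off_boundary[Tx|Tx] i j; first exact: schwarz hTheta hu2 Tx.
apply: schwarz hu2' Tx; exact/closed_openC/closed_closure.
Qed.

Lemma C1_at_Qsign x : ~ boundary Theta x ->
  C1_at x (Qsign Theta) (fun _ _ => 0).
Proof.
move=> /off_boundary[Tx|Tx].
  apply: C1_at_near (C1_at_cst x 1); last by move=> l; exact: near_forall.
  have : nbhs x Theta by exact: open_nbhs_nbhs.
  by apply: filterS => y Ty; rewrite /Qsign mem_set.
apply: C1_at_near (C1_at_cst x (-1)); last by move=> l; exact: near_forall.
have : nbhs x (~` closure Theta).
  by apply: open_nbhs_nbhs; split => //; exact/closed_openC/closed_closure.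
apply: filterS => y nTy; rewrite /Qsign memNset// => Ty; apply: nTy.
exact: subset_closure.
Qed.

Lemma C1_at_primitive x :
  C1_at x (fun y => primitive0 f (u y)) (fun j y => f (u y) * partial j u y).
Proof.
apply: C1_at_comp (Ck1_C1_at hu1 (x := x) I); last exact: cf.
by move=> t; exact: is_derive_primitive0.
Qed.

Lemma C1_at_primitive_field x j :
  C1_at x (fun y => primitive0 f (u y) * y ord0 j)
    (fun l y => primitive0 f (u y) * (l == j)%:R +
       y ord0 j * (f (u y) * partial l u y)).
Proof. exact: C1_atM (C1_at_primitive x) (C1_at_coord x j). Qed.

Lemma div_primitive_field x :
  \sum_j (primitive0 f (u x) * (j == j)%:R + x ord0 j * (f (u x) * partial j u
    x)) =
  n%:R * primitive0 f (u x) + f (u x) * radial_derivative x.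
Proof.
rewrite big_split/=; congr (_ + _).
  under eq_bigr do rewrite eqxx mulr1.
  by rewrite sumr_const card_ord mulr_natl.
by rewrite mulr_sumr; apply: eq_bigr => j _; ring.
Qed.

Definition dradial (l : 'I_n) x : R :=
  \sum_i (x ord0 i * partial l (partial i u) x + partial i u x * (l == i)%:R).

Definition dgrad_sq (l : 'I_n) x : R :=
  \sum_i (partial i u x * partial l (partial i u) x +
          partial i u x * partial l (partial i u) x).

Definition dstress (j l : 'I_n) x : R :=
  (radial_derivative x * partial l (partial j u) x + partial j u x * dradial l
    x) +
  (- 2^-1) * (grad_sq x * (l == j)%:R + x ord0 j * dgrad_sq l x).

Lemma C1_at_stress x : ~ boundary Theta x -> forall j,
  C1_at x (stress j) (dstress j).
Proof.
move=> nb j; have hd := C1_at_partial nb.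
have hg : C1_at x grad_sq dgrad_sq.
  by apply: C1_at_sum => k; exact: C1_atM.
have hr : C1_at x radial_derivative dradial.
  by apply: C1_at_sum => k; apply: C1_atM => //; exact: C1_at_coord.
have := C1_atD (C1_atM hr (hd j)) (C1_atZ (- 2^-1) (C1_atM hg (C1_at_coord x
  j))).
apply: C1_at_near => [|l]; last exact: near_forall.
by apply: near_forall => y; rewrite /stress mulNr.
Qed.

Lemma div_stressE x : ~ boundary Theta x ->
  \sum_j dstress j j x = div_stress x.
Proof.
move=> nb; rewrite /dstress big_split/= big_split/=.
have -> : \sum_j radial_derivative x * partial j (partial j u) x =
    - (Qsign Theta x * f (u x) * radial_derivative x).
  by rewrite -mulr_sumr -/(laplacian u x) -hsol//; ring.
rewrite -mulr_sumr big_split/=.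
have -> : \sum_(j < n) grad_sq x * (j == j)%:R = n%:R * grad_sq x.
  under eq_bigr do rewrite eqxx mulr1.
  by rewrite sumr_const card_ord mulr_natl.
(* The Hessian terms: the derivative of x . grad u contributes C, and that of |grad u|^2 contributes
   2 C by symmetry of the Hessian, which the factor - 1/2 cancels. *)
pose C := \sum_j \sum_i partial j u x * (x ord0 i * partial j (partial i u) x).
have -> : \sum_j partial j u x * dradial j x = C + grad_sq x.
  rewrite -big_split/=; apply: eq_bigr => j _; rewrite /dradial mulr_sumr.
  rewrite (eq_bigr (fun i => partial j u x * (x ord0 i * partial j (partial i
    u) x) +
      partial j u x * (partial i u x * (j == i)%:R))); last by move=> i _; ring.
  rewrite big_split/=; congr (_ + _).
  rewrite (bigD1 j)//= eqxx mulr1 big1 ?addr0// => i ij.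
  by rewrite eq_sym (negPf ij) !mulr0.
have -> : \sum_j x ord0 j * dgrad_sq j x = 2 * C.
  rewrite /C exchange_big/= mulr_sumr; apply: eq_bigr => j _.
  rewrite /dgrad_sq !mulr_sumr; apply: eq_bigr => i _.
  by rewrite (partialC nb i j); ring.
rewrite /div_stress; by field.
Qed.

End fields.

(** * Local form of the identity *)

Section test_functions.
Context {R : realType} {n : nat}.

Definition test_function (psi : 'rV[R]_n -> R) (dpsi : 'I_n -> 'rV[R]_n -> R) :=
  (forall x, C1_at x psi dpsi) /\ compactly_supported psi.

Lemma open_gradient_eq0 (O : set 'rV[R]_n) psi dpsi : open O ->
  (forall x, C1_at x psi dpsi) -> (forall x, O x -> psi x = 0) ->
  forall l x, O x -> dpsi l x = 0.
Proof.
move=> oO hpsi psi0 l x Ox; have [_ /(_ l)[dx _]] := hpsi x.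
have near0 : \forall y \near x, psi y = (cst 0 : _ -> R) y.
  have : nbhs x O by exact: open_nbhs_nbhs.
  by apply: filterS => y /psi0.
have := near_eq_derive (basis l) near0.
by rewrite derive_val derive_cst.
Qed.

(** Off the closed set [K] the product vanishes in a neighbourhood of x, so nothing is required of
    [g] there. *)
Lemma C1_at_cutoffM (K : set 'rV[R]_n) psi dpsi g dg x : closed K ->
  (forall x, C1_at x psi dpsi) -> (forall y, ~ K y -> psi y = 0) ->
  (K x -> C1_at x g dg) ->
  C1_at x (fun y => psi y * g y) (fun l y => psi y * dg l y + g y * dpsi l y).
Proof.
move=> cK hpsi psi0 hg; have [Kx|nKx] := pselect (K x).
  by apply: C1_atM; [exact: hpsi|exact: hg].
have oK : open (~` K) by exact: closed_openC.
have nK : nbhs x (~` K) by exact: open_nbhs_nbhs.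
apply: C1_at_near (C1_at_cst x 0).
  by apply: filterS nK => y /psi0 ->; rewrite mul0r.
move=> l; apply: filterS nK => y Ky.
by rewrite psi0// (open_gradient_eq0 oK hpsi psi0)// mul0r mulr0 addr0.
Qed.

Lemma test_function_lb psi dpsi : test_function psi dpsi ->
  locally_bounded psi /\ forall l, locally_bounded (dpsi l).
Proof.
move=> [hpsi _]; split.
  by apply: continuous_locally_bounded => x; have [] := hpsi x.
by move=> l; apply: continuous_locally_bounded => x;
  have [_ /(_ l)[]] := hpsi x.
Qed.

Lemma test_function_cs psi dpsi : test_function psi dpsi ->
  forall l, compactly_supported (dpsi l).
Proof.
move=> [hpsi [r hr]] l; exists r => x rx.
apply: (open_gradient_eq0 (O := [set x | r < `|x|]) _ hpsi) => //.
rewrite (_ : [set _ | _] = (fun x : 'rV[R]_n => `|x|) @^-1` [set t | r < t]) //.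
by apply: open_comp; [move=> y _; exact: norm_continuous|exact: open_gt].
Qed.

End test_functions.

Section local_flux.
Context {R : realType} {n : nat}.
Variables (Theta : set 'rV[R]_n.+1) (f : R -> R) (u : 'rV[R]_n.+1 -> R).
Hypotheses (hTheta : open Theta) (cf : continuous f).
Hypotheses (hu1 : Ck 1 setT u) (hu2 : Ck 2 Theta u) (hu2' : Ck 2 (~` closure
  Theta) u).
Hypothesis hsol : forall x, ~ boundary Theta x ->
  - laplacian u x = Qsign Theta x * f (u x).
Variables (nu : 'rV[R]_n.+1 -> 'rV[R]_n.+1).
Hypothesis hnu : exterior_unit_normal Theta nu.
Variable sigma : {measure set 'rV[R]_n.+1 -> \bar R}.
Hypothesis hsigma : surface_measure Theta sigma.

Local Notation Q := (Qsign Theta).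
Local Notation Fu := (fun x => primitive0 f (u x)).
Local Notation density := (pohozaev_density Theta f u).
Local Notation flux := (pohozaev_flux Theta f u).
Local Notation mu := (lebesgue_rV n.+1).

Definition boundary_term z : R := primitive0 f (u z) * dotp z (nu z).

(** The identity tested against [psi], with [dpsi] as its gradient: it says in the weak sense that
    the divergence of the flux is the density plus a surface term. The factor 2 is the jump of Q,
    from 1 inside to -1 outside. *)
Definition flux_identity (psi : 'rV[R]_n.+1 -> R) dpsi : Prop :=
  sigma.-integrable (boundary Theta) (EFin \o (fun z =>
    psi z * boundary_term z)) /\
  \int[mu]_x (psi x * density x + \sum_j dpsi j x * flux j x) =
  2 * \int[sigma]_(z in boundary Theta) (psi z * boundary_term z).

Let cdu j : continuous (partial j u).
Proof. by move=> x; have [_ /(_ j)[]] := Ck1_C1_at hu1 (x := x) I. Qed.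

Let cu : continuous u.
Proof. by move=> x; have [] := Ck1_C1_at hu1 (x := x) I. Qed.

Let cFu : continuous Fu.
Proof. by move=> x; have [] := C1_at_primitive cf hu1 x. Qed.

Let lb_du j : locally_bounded (partial j u).
Proof. exact: continuous_locally_bounded. Qed.

Let lb_coord j : locally_bounded (fun x : 'rV[R]_n.+1 => x ord0 j).
Proof. by apply: continuous_locally_bounded; exact: coord_continuous. Qed.

Lemma Qsign_locally_bounded : locally_bounded Q.
Proof.
split.
  have -> : Q = (fun x => 2 * \1_Theta x - 1).
    apply/funext => x; rewrite /Qsign indicE.
    by case: (x \in Theta); rewrite ?mulr1 ?mulr0; lra.
  apply: measurable_funB => //; apply: measurable_funM => //.
  by apply: measurable_indic; exact: open_measurable_rV.
by move=> r; exists 1 => x _; rewrite /Qsign; case: ifP; rewrite ?normrN normr1.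
Qed.

Lemma grad_sq_locally_bounded : locally_bounded (grad_sq u).
Proof. by apply: locally_bounded_sum => j; exact: locally_boundedM. Qed.

Let lb_radial : locally_bounded (radial_derivative u).
Proof. by apply: locally_bounded_sum => j; exact: locally_boundedM. Qed.

Let lb_fu : locally_bounded (fun x => f (u x)).
Proof.
apply: continuous_locally_bounded => x.
by apply: (@continuous_comp _ _ _ u f); [exact: cu|exact: cf].
Qed.

Let lb_Fu : locally_bounded Fu.
Proof. exact: continuous_locally_bounded. Qed.

Let lbN g : locally_bounded g -> @locally_bounded R n.+1 (fun x => - g x).
Proof.
move=> lg; have := locally_boundedM (locally_bounded_cst (-1)) lg.
by congr locally_bounded; apply/funext => x; rewrite mulN1r.
Qed.

Let continuous_stress j : continuous (stress u j).
Proof.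
have crad : continuous (radial_derivative u).
  move=> x; apply: continuous_sum => k.
  by apply: continuousM; [exact: coord_continuous|exact: cdu].
have cgs : continuous (grad_sq u).
  by move=> x; apply: continuous_sum => k; apply: continuousM; exact: cdu.
move=> x; apply: (@continuousB _ _ _ (fun y => radial_derivative u y * partial
  j u y)
  (fun y => 2^-1 * (grad_sq u y * y ord0 j))).
  by apply: continuousM; [exact: crad|exact: cdu].
apply: continuousM; first exact: cst_continuous.
by apply: continuousM; [exact: cgs|exact: coord_continuous].
Qed.

Lemma density_locally_bounded : locally_bounded density.
Proof.
apply: locally_boundedD.
  by apply: locally_boundedM; [exact: locally_bounded_cst|exact:
    grad_sq_locally_bounded].
apply: locally_boundedM; first exact: locally_bounded_cst.
by apply: locally_boundedM => //; exact: Qsign_locally_bounded.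
Qed.

Lemma flux_locally_bounded j : locally_bounded (flux j).
Proof.
apply: locally_boundedD; first exact: continuous_locally_bounded.
apply: locally_boundedM; first exact: Qsign_locally_bounded.
exact: locally_boundedM.
Qed.

Let lb_div_stress : locally_bounded (div_stress Theta f u).
Proof.
apply: locally_boundedD.
  by apply: locally_boundedM; [exact: locally_bounded_cst|exact:
    grad_sq_locally_bounded].
apply: lbN; apply: locally_boundedM => //; apply: locally_boundedM => //.
exact: Qsign_locally_bounded.
Qed.

Section test.
Variables (psi : 'rV[R]_n.+1 -> R) (dpsi : 'I_n.+1 -> 'rV[R]_n.+1 -> R).
Hypothesis hpsi : test_function psi dpsi.

(** [D1] and [D2] are the divergences, off the boundary, of psi T and of psi F(u) x. They are
    separated because only the second field is multiplied by Q, hence jumps. *)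
Let D1 x := psi x * div_stress Theta f u x + \sum_j stress u j x * dpsi j x.

Let D2 x := psi x * (n.+1%:R * Fu x + f (u x) * radial_derivative u x) +
  \sum_j (Fu x * x ord0 j) * dpsi j x.

Let integrandE x :
  psi x * density x + \sum_j dpsi j x * flux j x = D1 x + Q x * D2 x.
Proof.
have -> : \sum_j dpsi j x * flux j x = \sum_j stress u j x * dpsi j x +
    Q x * \sum_j (Fu x * x ord0 j) * dpsi j x.
  rewrite mulr_sumr -big_split/=; apply: eq_bigr => j _.
  by rewrite /pohozaev_flux; ring.
by rewrite /D1 /D2 /pohozaev_density /div_stress; ring.
Qed.

Lemma integrable_flux_integrand : mu.-integrable setT
  (EFin \o (fun x => psi x * density x + \sum_j dpsi j x * flux j x)).
Proof.
have [lbp lbdp] := test_function_lb hpsi; have cdp := test_function_cs hpsi.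
apply: locally_bounded_integrable.
  apply: locally_boundedD.
    by apply: locally_boundedM => //; exact: density_locally_bounded.
  by apply: locally_bounded_sum => j; apply: locally_boundedM => //;
    exact: flux_locally_bounded.
apply: compactly_supportedD; first by apply: compactly_supportedMl;
  exact: hpsi.2.
by apply: compactly_supported_sum => j; exact: compactly_supportedMl.
Qed.

Variable K : set 'rV[R]_n.+1.
Hypotheses (cK : closed K) (psi0 : forall y, ~ K y -> psi y = 0).

Let hp1 := hpsi.1.

Let dpsi0 l y : ~ K y -> dpsi l y = 0.
Proof. exact: (open_gradient_eq0 (closed_openC cK) hp1 psi0). Qed.

(** Q is locally constant near [K], so psi times the flux is of class C^1 on the whole space and its
    divergence has zero integral. *)
Lemma flux_identity_off_boundary : (forall x, K x -> ~ boundary Theta x) ->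
  flux_identity psi dpsi.
Proof.
move=> Kb.
have bd0 z : boundary Theta z -> psi z * boundary_term z = 0.
  by move=> bz; rewrite psi0 ?mul0r// => Kz; exact: Kb bz.
split.
  apply/(integrable_mkcond _ (boundary_measurable Theta)).2.
  rewrite (_ : _ \_ _ = cst 0%E); first exact: integrable0.
  by apply/funext => z; rewrite /patch; case: ifPn => //; rewrite inE =>
    /bd0/= ->.
have -> : \int[sigma]_(z in boundary Theta) (psi z * boundary_term z) = 0.
  transitivity (\int[sigma]_(z in boundary Theta) (0 : R)).
    by apply: eq_Rintegral => z; rewrite inE => /bd0.
  by rewrite Rintegral_cst ?mul0r//; exact: boundary_measurable.
rewrite mulr0.
pose dV j l x := dstress u j l x + (Q x * (primitive0 f (u x) * (l == j)%:R +
       x ord0 j * (f (u x) * partial l u x)) + (Fu x * x ord0 j) * 0).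
have hV j x : K x -> C1_at x (flux j) (dV j).
  move=> /Kb nb; apply: C1_atD; first exact: C1_at_stress nb j.
  by apply: C1_atM; [exact: C1_at_Qsign|exact: C1_at_primitive_field].
have hY j x := C1_at_cutoffM cK hp1 psi0 (hV j x).
have cY j : compactly_supported (fun y => psi y * flux j y).
  by apply: compactly_supportedMl; exact: hpsi.2.
have iY j : mu.-integrable setT (EFin \o
    (fun y => psi y * dV j j y + flux j y * dpsi j y)).
  apply: locally_bounded_integrable.
    by apply: continuous_locally_bounded => x; have [_ /(_ j)[]] := hY j x.
  have [r hr] := cY j; exists r; exact: (support_gradient (hY j) hr).
transitivity (\int[mu]_x \sum_j (psi x * dV j j x + flux j x * dpsi j x));
  last first.
  rewrite /Rintegral.
  have -> : (\int[mu]_x (\sum_j (psi x * dV j j x + flux j x * dpsi j x))%:E)%E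
    =
      (\sum_j \int[mu]_x (psi x * dV j j x + flux j x * dpsi j x)%:E)%E.
    transitivity (\int[mu]_x \sum_j (psi x * dV j j x + flux j x * dpsi j
      x)%:E)%E.
      by apply: eq_integral => x _; rewrite sumEFin.
    by apply: integral_sum => // j; exact: iY.
  by rewrite big1// => j _; exact: (integral_partial_eq0 _ (hY j)).
apply: eq_Rintegral => x _; rewrite big_split/= -mulr_sumr.
have [Kx|nKx] := pselect (K x); last first.
  by rewrite psi0// !mul0r !big1// => j _; rewrite dpsi0// ?mul0r ?mulr0.
congr (_ + _); last by apply: eq_bigr => j _; rewrite mulrC.
have nb := Kb _ Kx; congr (_ * _).
under [RHS]eq_bigr do rewrite /dV mulr0 addr0.
rewrite big_split/= (div_stressE hTheta hu2 hu2' hsol nb) -mulr_sumr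
  div_primitive_field.
rewrite /pohozaev_density /div_stress; ring.
Qed.

Variables (U : set 'rV[R]_n.+1) (i : 'I_n.+1) (b : bool) (gam : 'rV[R]_n -> R).
Hypotheses (hch : graph_chart Theta U i b gam) (KU : K `<=` U).

Local Notation s := (graph_height i gam).

Let off_graph_eq (g h : 'rV[R]_n.+1 -> R) : measurable_fun setT g ->
  measurable_fun setT h -> (forall x, s x != 0 -> g x = h x) ->
  \int[mu]_x g x = \int[mu]_x h x.
Proof.
move=> mg mh gh; rewrite /Rintegral; congr fine; apply: ae_eq_integral => //.
- exact/measurable_EFinP.
- exact/measurable_EFinP.
exists [set x | s x = 0]; split; last 2 first.
- exact: graph_null hch.
- move=> x /= gx; apply: contrapT => /eqP sx; apply: gx => _.
  by rewrite gh.
rewrite (_ : [set _ | _] = s @^-1` [set 0]) // -[X in measurable X]setTI.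
by apply: (continuous_measurable_fun_rV (D := setT) (graph_height_continuous
  hch)).
Qed.

(** The jump formula is applied to psi T with constants 1 and 1, and to psi F(u) x with constants c
    and - c, where c = (-1)^b. The jump 2 c of the latter is twice the sign relating the conormal to
    the exterior normal. *)
Lemma flux_identity_chart : flux_identity psi dpsi.
Proof.
have [lbp lbdp] := test_function_lb hpsi; have cdp := test_function_cs hpsi.
have spsi := hpsi.2.
have cpsi : continuous psi by move=> x; have [] := hp1 x.
have nb x : s x != 0 -> U x -> ~ boundary Theta x.
  by move=> sx Ux bx; move/eqP: sx; apply; exact/(boundary_chart hTheta hch Ux).
have [c1 cc] : `|(-1) ^+ b| <= 1 :> R /\ (-1) ^+ b - - (-1) ^+ b =
  2 * (-1) ^+ b :> R.
  by split; [rewrite normrX normrN1 expr1n|ring].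
set c : R := (-1) ^+ b in c1 cc.
pose W (j : 'I_n.+1) x := psi x * (Fu x * x ord0 j).
have hW j x := C1_atM (hp1 x) (C1_at_primitive_field cf hu1 x j).
have cW j : continuous (W j) by move=> x; have [] := hW j x.
have sW j : compactly_supported (W j) by exact: compactly_supportedMl.
have lbD1 : locally_bounded D1.
  apply: locally_boundedD; first exact: locally_boundedM.
  apply: locally_bounded_sum => j; apply: locally_boundedM => //.
  exact: continuous_locally_bounded.
have sD1 : compactly_supported D1.
  apply: compactly_supportedD; first exact: compactly_supportedMl.
  by apply: compactly_supported_sum => j; exact: compactly_supportedMr.
have lbD2 : locally_bounded D2.
  apply: locally_boundedD.
    apply: locally_boundedM => //; apply: locally_boundedD;
      apply: locally_boundedM => //.
    exact: locally_bounded_cst.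
  by apply: locally_bounded_sum => j; apply: locally_boundedM => //;
    exact: locally_boundedM.
have sD2 : compactly_supported D2.
  apply: compactly_supportedD; first exact: compactly_supportedMl.
  by apply: compactly_supported_sum => j; exact: compactly_supportedMr.
have hT x : s x != 0 -> forall j, C1_at x (fun y => psi y * stress u j y)
    (fun l y => psi y * dstress u j l y + stress u j y * dpsi l y).
  move=> sx j; apply: (C1_at_cutoffM cK hp1 psi0) => Kx.
  by apply: C1_at_stress (nb _ sx _) j => //; exact: KU.
have cT j : continuous (fun y => psi y * stress u j y).
  by move=> x; apply: continuousM; [exact: cpsi|exact: continuous_stress].
have sT j : compactly_supported (fun y => psi y * stress u j y).
  exact: compactly_supportedMl.
have dT x : s x != 0 ->
    \sum_j (psi x * dstress u j j x + stress u j x * dpsi j x) = D1 x.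
  move=> sx; rewrite big_split/= -mulr_sumr /D1; congr (_ + _).
  have [Kx|nKx] := pselect (K x); last by rewrite psi0// !mul0r.
  by rewrite (div_stressE hTheta hu2 hu2' hsol (nb _ sx (KU Kx))).
have n1 : `|1 : R| <= 1 by rewrite normr1.
(* [stress] is continuous across the graph, hence the same constant on both
   sides; below, [side_value c (- c) (s x)] is [- Q x] on U. *)
have A := graph_jump (chart_C1 hch) n1 n1 cT sT hT lbD1 sD1 dT.
have dW x : s x != 0 -> \sum_j (psi x * (Fu x * (j == j)%:R +
    x ord0 j * (f (u x) * partial j u x)) + Fu x * x ord0 j * dpsi j x) = D2 x.
  by move=> _; rewrite big_split/= -mulr_sumr div_primitive_field.
have cN1 : `|- c| <= 1 by rewrite normrN.
have B := graph_jump (chart_C1 hch) c1 cN1 cW sW (fun x _ j =>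
  hW j x) lbD2 sD2 dW.
have W0 j x : ~ U x -> W j x = 0.
  by move=> nUx; rewrite /W psi0 ?mul0r// => /KU.
have gE z : boundary Theta z -> psi z * boundary_term z =
  \sum_j W j z * nu z ord0 j.
  move=> _; rewrite /boundary_term /dotp !mulr_sumr; apply: eq_bigr => j _.
  by rewrite /W; ring.
have [ib Ib] := chart_boundary_integral hTheta hch hnu hsigma cW sW W0 gE.
split => //; rewrite Ib.
pose a_ x := side_value 1 1 (s x) * D1 x.
pose b_ x := side_value c (- c) (s x) * D2 x.
have lbs := @locally_bounded_side_value R n i gam _ (chart_C1 hch).
have ia : mu.-integrable setT (EFin \o a_).
  apply: locally_bounded_integrable; last exact: compactly_supportedMr.
  exact: locally_boundedM.
have ibb : mu.-integrable setT (EFin \o b_).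
  apply: locally_bounded_integrable; last exact: compactly_supportedMr.
  exact: locally_boundedM.
(* The integrands agree only off the graph: on [K] because Q is the opposite of the side value,
   elsewhere because [D2] vanishes with [psi] and [dpsi]. The graph is a null set. *)
transitivity (\int[mu]_x (a_ x - b_ x)).
  apply: off_graph_eq.
  - by apply/measurable_EFinP; exact: measurable_int integrable_flux_integrand.
  - apply: measurable_funB; apply/measurable_EFinP;
      [exact: measurable_int ia|exact: measurable_int ibb].
  move=> x sx; rewrite integrandE /a_ /b_ -mulNr; congr (_ + _).
    by rewrite /side_value; case: (ltrgtP (s x) 0) sx => //;
      rewrite ?mul1r ?eqxx.
  have [Kx|nKx] := pselect (K x); last first.
    have -> : D2 x = 0.
      by rewrite /D2 psi0// mul0r add0r big1// => j _; rewrite dpsi0// mulr0.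
    by rewrite !mulr0.
  congr (_ * _); rewrite (chart_Qsign hch (KU Kx) sx) -/c /side_value.
  case: (ltrgtP (s x) 0) sx => [sx|sx|->] _; last by rewrite sgr0 mulr0.
    by rewrite ltr0_sg//; ring.
  by rewrite gtr0_sg//; ring.
rewrite RintegralB//.
move: A B; rewrite -/(a_) subrr mul0r addr0 cc => -> /eqP.
rewrite addr_eq0 => /eqP; rewrite -/(b_) => ->.
by rewrite sub0r opprK mulrA.
Qed.

End test.

End local_flux.

(** * Localization *)

Section bump.
Context {R : realType} {n : nat}.

Lemma C1_prod (I : Type) (r : seq I) (g : I -> 'rV[R]_n -> R) :
  (forall k, exists dg, forall x, C1_at x (g k) dg) ->
  exists dg, forall x, C1_at x (fun y => \prod_(k <- r) g k y) dg.
Proof.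
move=> hg; elim: r => [|k r [dh hh]].
  exists (fun _ _ => 0) => x; apply: C1_at_near (C1_at_cst x 1).
    by apply: near_forall => y; rewrite big_nil.
  by move=> l; exact: near_forall.
have [dg hdg] := hg k.
exists (fun i y => g k y * dh i y + (\prod_(k <- r) g k y) * dg i y) => x.
apply: C1_at_near (C1_atM (hdg x) (hh x)).
  by apply: near_forall => y; rewrite big_cons.
by move=> l; exact: near_forall.
Qed.

(** For the sup norm, a product of one-variable transitions over the coordinates is already a
    bump. *)
Lemma exists_bump (z : 'rV[R]_n) (d : R) : 0 < d ->
  exists chi dchi, [/\ forall x, C1_at x chi dchi,
    forall x, `|x - z| <= d -> chi x = 1 &
    forall x, 2 * d < `|x - z| -> chi x = 0].
Proof.
move=> d0.
(* With t = (x_k - z_k) / d, the two factors are step (2 + t) and step (2 - t): both are 1 when |t|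
   <= 1, and one of them is 0 when |t| > 2. *)
pose g (a : R) (k : 'I_n) (x : 'rV[R]_n) := step (a * (d^-1 * (x ord0 k + - z
  ord0 k)) + 2).
have hg a k : exists dg, forall x, C1_at x (g a k) dg.
  eexists => x; apply: C1_at_comp; [exact: is_derive_step|exact:
    dstep_continuous|].
  apply: C1_atD (C1_at_cst x 2); apply: C1_atZ; apply: C1_atZ.
  exact: (C1_atD (C1_at_coord x k) (C1_at_cst x _)).
have [dchi hchi] : exists dchi, forall x,
    C1_at x (fun y => \prod_(k < n) (g 1 k y * g (-1) k y)) dchi.
  apply: C1_prod => k; have [dg1 h1] := hg 1 k; have [dg2 h2] := hg (-1) k.
  by eexists => x; exact: C1_atM.
exists (fun y => \prod_(k < n) (g 1 k y * g (-1) k y)), dchi; split => //.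
- move=> x xd; apply: big1 => k _.
  have : `|d^-1 * (x ord0 k + - z ord0 k)| <= 1.
    rewrite normrM gtr0_norm ?invr_gt0// mulrC ler_pdivrMr// mul1r.
    apply: le_trans xd; have := coord_le_norm (x - z) k; by rewrite !mxE.
  rewrite ler_norml => /andP[t1 t2].
  by rewrite /g !step_ge1 ?mulr1//; lra.
- move=> x dx; have [k xk] : exists k, 2 * d < `|(x - z) ord0 k|.
    apply: contrapT => nk; move: dx; apply/negP; rewrite -leNgt.
    have d20 : 0 <= 2 * d by rewrite mulr_ge0// ltW.
    have : cube n (2 * d) (x - z).
      move=> k /=; rewrite -ler_norml leNgt; apply/negP => h; apply: nk.
      by exists k.
    by rewrite cubeE.
  rewrite (bigD1 k)//=; suff -> : g 1 k x * g (-1) k x = 0 by rewrite mul0r.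
  have : 2 < `|d^-1 * (x ord0 k + - z ord0 k)|.
    rewrite normrM gtr0_norm ?invr_gt0// mulrC ltr_pdivlMr//.
    by move: xk; rewrite !mxE.
  rewrite ltr_normr => /orP[] t2.
    by rewrite /g [step (-1 * _ + _)]step_le0 ?mulr0//; lra.
  by rewrite /g [step (1 * _ + _)]step_le0 ?mul0r//; lra.
Qed.

End bump.

Section localization.
Context {R : realType} {n : nat}.
Variables (Theta : set 'rV[R]_n.+1) (f : R -> R) (u : 'rV[R]_n.+1 -> R).
Hypotheses (hTheta : smooth_open Theta) (cf : continuous f).
Hypotheses (hu1 : Ck 1 setT u) (hu2 : Ck 2 Theta u) (hu2' : Ck 2 (~` closure
  Theta) u).
Hypothesis hsol : forall x, ~ boundary Theta x ->
  - laplacian u x = Qsign Theta x * f (u x).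
Variables (nu : 'rV[R]_n.+1 -> 'rV[R]_n.+1).
Hypothesis hnu : exterior_unit_normal Theta nu.
Variable sigma : {measure set 'rV[R]_n.+1 -> \bar R}.
Hypothesis hsigma : surface_measure Theta sigma.

Local Notation flux_id := (flux_identity Theta f u nu sigma).

Let closed_ball_closed (z : 'rV[R]_n.+1) (r : R) : closed [set x | `|x - z| <=
  r].
Proof.
rewrite (_ : [set _ | _] = (fun x : 'rV[R]_n.+1 =>
  `|x - z|) @^-1` [set t | t <= r]) //.
apply: closed_comp; last exact: closed_le.
move=> x _; have cz : {for x, continuous (fun=> z)} by exact: cst_continuous.
exact: (cvg_norm (continuousB (@continuous_id _ x) cz)).
Qed.

(** The radius [2 * d] matches the support of the bump that [exists_bump] provides for [d]. *)
Lemma locally_flux_identity (z : 'rV[R]_n.+1) : exists2 d : R, 0 < d &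
  forall psi dpsi, test_function psi dpsi ->
    (forall x, 2 * d < `|x - z| -> psi x = 0) -> flux_id psi dpsi.
Proof.
have shrink (O : set 'rV[R]_n.+1) : open O -> O z -> exists2 d : R, 0 < d &
    [set x | `|x - z| <= 2 * d] `<=` O.
  move=> oO Oz; have /nbhs_ballP[e /= e0 he] : nbhs z O by exact:
    open_nbhs_nbhs.
  exists (e / 4); first by rewrite divr_gt0.
  move=> x /= xz; apply: he; rewrite -ball_normE/= distrC (le_lt_trans xz)//;
    lra.
have [oT bT] := hTheta.
have [bz|nbz] := pselect (boundary Theta z).
  have [U [i [b [gam [hch Uz]]]]] := bT z bz.
  have [oU _ _] := hch.
  have [d d0 hd] := shrink U oU Uz; exists d => // psi dpsi hpsi psi0.
  apply: (flux_identity_chart oT cf hu1 hu2 hu2' hsol hnu hsigma hpsi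
    (closed_ball_closed (z := z) (r := 2 * d)) _ hch hd).
  by move=> y /= /negP; rewrite -ltNge; exact: psi0.
have oC : open (~` boundary Theta).
  rewrite /boundary setDE setCI setCK; apply: openU; last exact: open_interior.
  exact/closed_openC/closed_closure.
have [d d0 hd] := shrink _ oC nbz; exists d => // psi dpsi hpsi psi0.
apply: (flux_identity_off_boundary oT cf hu1 hu2 hu2' hsol _ _ hpsi
  (closed_ball_closed (z := z) (r := 2 * d))).
- by move=> y /= /negP; rewrite -ltNge; exact: psi0.
- by move=> x; exact: hd.
Qed.

Lemma flux_identityD psi1 dpsi1 psi2 dpsi2 psi dpsi :
  test_function psi1 dpsi1 -> test_function psi2 dpsi2 ->
  (forall x, psi x = psi1 x + psi2 x) ->
  (forall l x, dpsi l x = dpsi1 l x + dpsi2 l x) ->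
  flux_id psi1 dpsi1 -> flux_id psi2 dpsi2 -> flux_id psi dpsi.
Proof.
move=> t1 t2 e de [i1 E1] [i2 E2].
have mb := boundary_measurable Theta.
have eb : (fun z => psi z * boundary_term f u nu z) =
    (fun z => psi1 z * boundary_term f u nu z + psi2 z * boundary_term f u nu
      z).
  by apply/funext => z; rewrite e mulrDl.
split.
  by rewrite eb; exact: (integrableD mb i1 i2).
have -> : \int[sigma]_(z in boundary Theta) (psi z * boundary_term f u nu z) =
    \int[sigma]_(z in boundary Theta) (psi1 z * boundary_term f u nu z) +
    \int[sigma]_(z in boundary Theta) (psi2 z * boundary_term f u nu z).
  by rewrite eb RintegralD.
rewrite mulrDr -E1 -E2 -RintegralD//; first last.
- by have := integrable_flux_integrand hTheta.1 cf hu1 t2.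
- by have := integrable_flux_integrand hTheta.1 cf hu1 t1.
apply: eq_Rintegral => x _; rewrite e mulrDl addrACA; congr (_ + _).
by rewrite -big_split/=; apply: eq_bigr => l _; rewrite de mulrDl.
Qed.

Lemma flux_identity_test psi dpsi : test_function psi dpsi -> flux_id psi dpsi.
Proof.
move=> hpsi.
have /choice[d hd] : forall z, exists d : R, 0 < d /\
  forall psi dpsi, test_function psi dpsi ->
    (forall x, 2 * d < `|x - z| -> psi x = 0) -> flux_id psi dpsi.
  by move=> z; have [d d0 h] := locally_flux_identity z; exists d.
(* psi = psi chi + psi (1 - chi), where the second term vanishes on the ball on
   which chi = 1: no partition of unity is needed. *)
have cover_case (l : seq 'rV[R]_n.+1) : forall psi dpsi,
  test_function psi dpsi ->
    (forall x, psi x != 0 -> exists2 z, z \in l & `|x - z| <= d z) ->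
    flux_id psi dpsi.
  elim: l => [|z l IH] p dp hp hc.
    (* With no ball left the test function is identically zero, and the case off the boundary
       applies with [K] empty. *)
    have p0 x : p x = 0.
      by apply/eqP/negPn/negP => /hc[].
    apply: (flux_identity_off_boundary hTheta.1 cf hu1 hu2 hu2' hsol _ _ hp
      closed0) => //.
  have [d0 hz] := hd z.
  have [chi [dchi [hchi chi1 chi0]]] := exists_bump z d0.
  have t1 : test_function (fun y => p y * chi y)
      (fun l y => p y * dchi l y + chi y * dp l y).
    split; first by move=> x; exact: (C1_atM (hp.1 x) (hchi x)).
    by apply: compactly_supportedMl; exact: hp.2.
  have t2 : test_function (fun y => p y + (-1) * (p y * chi y))
      (fun l y => dp l y + (-1) * (p y * dchi l y + chi y * dp l y)).
    split; first by move=> x; exact: (C1_atD (hp.1 x) (C1_atZ (-1) (t1.1 x))).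
    apply: compactly_supportedD; first exact: hp.2.
    apply: compactly_supportedMr; exact: t1.2.
  apply: (flux_identityD t1 t2).
  - by move=> x; ring.
  - by move=> k x; ring.
  - by apply: hz => // x xz; rewrite chi0// mulr0.
  - apply: IH => // x hx.
    have px : p x != 0 by apply: contra_neq hx => ->; ring.
    have [z' z'l xz'] := hc _ px; exists z' => //.
    (* The ball around z is excluded: [chi] is 1 on it, so the remainder p - p chi vanishes at x. *)
    move: z'l; rewrite inE => /orP[/eqP zz|//]; exfalso.
    by move/eqP: hx; apply; rewrite chi1 -?zz//; ring.
have [r hr] := hpsi.2.
have cptA : compact [set x : 'rV[R]_n.+1 | `|x - 0| <= `|r|].
  apply: bounded_closed_compact; last exact: closed_ball_closed.
  exists `|r|; split; first exact: num_real.
  by move=> t rt x /=; rewrite subr0 => xr; exact/(le_trans xr)/ltW.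
have [D' _ covD] : finite_subset_cover [set: 'rV[R]_n.+1] (fun z =>
  ball z (d z))
    [set x : 'rV[R]_n.+1 | `|x - 0| <= `|r|].
  move: cptA; rewrite compact_cover; apply.
    by move=> z _; exact: ball_open.
  by move=> x _; exists x => //; apply: ballxx; exact: (hd x).1.
apply: (cover_case (finmap.enum_fset D')) => // x px.
have [|z zD zx] := covD x.
  rewrite /= subr0 leNgt; apply/negP => rx; move/eqP: px; apply; apply: hr.
  exact: le_lt_trans (ler_norm r) rx.
exists z => //; move: zx; rewrite -ball_normE/= distrC; exact: ltW.
Qed.

End localization.

(** * Dilated cutoffs *)

Section cutoffs.
Context {R : realType} {n : nat}.
Implicit Types (x : 'rV[R]_n).

(** [cutoff] is stated with the Euclidean norm, [compactly_supported] with the sup norm; this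
    comparison and the next one translate between them. *)
Lemma enorm_ge_norm x : `|x| <= enorm x.
Proof.
have : cube n (enorm x) x.
  move=> k /=; rewrite -ler_norml -sqrtr_sqr ler_wsqrtr// /dotp (bigD1 k)//=
    -expr2.
  by rewrite lerDl sumr_ge0// => j _; rewrite -expr2 sqr_ge0.
by rewrite cubeE// sqrtr_ge0.
Qed.

Lemma enorm_le_norm x : enorm x <= Num.sqrt (n%:R * `|x| ^+ 2).
Proof.
rewrite ler_wsqrtr// /dotp mulr_natl -[X in _ *+ X](card_ord n) -sumr_const.
apply: ler_sum => j _; rewrite -expr2 -real_normK ?num_real//.
by rewrite lerXn2r ?nnegrE// coord_le_norm.
Qed.

(** Needed for the clause of [boundary_integral] on integrable functions, in which no cutoff is
    given. *)
Lemma exists_cutoff : exists phi : 'rV[R]_n -> R, cutoff phi.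
Proof.
have [chi [dchi [hchi chi1 chi0]]] := exists_bump (0 : 'rV[R]_n) (@ltr01 R).
have dE i : partial i chi = dchi i.
  by apply/funext => x; have [_ /(_ i)[dx _]] := hchi x; exact: derive_val.
exists chi; split.
- split=> [[|//] x _ _ i|[|i [|//]] x _ _] /=.
  + by have [_ /(_ i)[[]]] := hchi x.
  + by have [] := hchi x.
  + by rewrite dE; have [_ /(_ i)[]] := hchi x.
- apply/nbhs_ballP; exists 1 => //= x; rewrite -ball_normE/= => h.
  by apply: chi1; rewrite -normrN opprB ltW.
- exists (Num.sqrt (n%:R * 2 ^+ 2)) => x hx; apply: chi0.
  rewrite subr0 mulr1 ltNge; apply/negP => x2.
  move: hx; apply/negP; rewrite -leNgt; apply: le_trans (enorm_le_norm x) _.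
  by rewrite ler_wsqrtr// ler_wpM2l// lerXn2r ?nnegrE.
Qed.

Lemma cutoff_test (phi : 'rV[R]_n -> R) : cutoff phi ->
  test_function phi (fun i => partial i phi).
Proof.
move=> [phi1 _ [M hM]]; split; first by move=> x; exact: (Ck1_C1_at phi1).
by exists M => x Mx; apply: hM; exact: lt_le_trans (enorm_ge_norm x).
Qed.

Lemma test_function_scale (psi : 'rV[R]_n -> R) dpsi (r : R) : 0 < r ->
  test_function psi dpsi ->
  test_function (fun x => psi (r^-1 *: x)) (fun l x =>
    r^-1 * dpsi l (r^-1 *: x)).
Proof.
move=> r0 [hpsi [M hM]].
have cr : continuous (fun x : 'rV[R]_n => r^-1 *: x) by exact:
  scaler_continuous.
split; last first.
  exists (r * M) => x Mx; apply: hM.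
  by rewrite normrZ gtr0_norm ?invr_gt0// mulrC ltr_pdivlMr// mulrC.
move=> x; have [cpsi dps] := hpsi (r^-1 *: x); split.
  by apply: (@continuous_comp _ _ _ (fun x => r^-1 *: x) psi);
    [exact: cr|exact: cpsi].
move=> l; have [dl cl] := dps l; split.
  apply: (proj1 (@is_derive_precomp _ _ _ (fun x => r^-1 *: x) psi x (basis l)
    (r^-1 *: basis l) _ _)).
    by move=> h; rewrite scalerDr !scalerA mulrC.
  exact: is_derive_scale_dir.
have ck : {for x, continuous (fun=> r^-1)} by exact: cst_continuous.
apply: (continuousM ck).
by apply: (@continuous_comp _ _ _ (fun x => r^-1 *: x) (dpsi l));
  [exact: cr|exact: cl].
Qed.

Lemma compactly_supported_bounded (g : 'rV[R]_n -> R) : continuous g ->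
  compactly_supported g -> exists2 C : R, 0 <= C & forall x, `|g x| <= C.
Proof.
move=> cg [r hr]; have [_ /(_ `|r|)[C hC]] := continuous_locally_bounded cg.
exists `|C| => // x; have [xr|rx] := leP `|x| `|r|.
  exact/(le_trans (hC _ xr))/ler_norm.
by rewrite hr ?normr0//; exact: le_lt_trans (ler_norm r) rx.
Qed.

Lemma scaled_near0 (P : set 'rV[R]_n) x : nbhs (0 : 'rV[R]_n) P ->
  forall r_ : nat -> R, r_ k @[k --> \oo] --> +oo ->
  \forall k \near \oo, P ((r_ k)^-1 *: x).
Proof.
move=> /nbhs_ballP[e /= e0 he] r_ rr.
have : \forall k \near \oo, `|x| / e < r_ k by have /cvgryPgt := rr; exact.
apply: filterS => k hk; apply: he.
have rk0 : 0 < r_ k by apply: le_lt_trans hk; rewrite divr_ge0// ltW.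
rewrite -ball_normE/= sub0r normrN normrZ gtr0_norm ?invr_gt0// mulrC.
by rewrite ltr_pdivrMr// mulrC -ltr_pdivrMr.
Qed.

End cutoffs.

(** * Passage to the limit in the volume integrals *)

Section limit.
Context {R : realType} {n : nat}.
Variables (Theta : set 'rV[R]_n.+1) (f : R -> R) (u : 'rV[R]_n.+1 -> R).
Hypotheses (oT : open Theta) (cf : continuous f) (hu1 : Ck 1 setT u).
Hypothesis du2 : forall i, partial i u \in Lfun (lebesgue_rV n.+1) 2%:E.
Hypothesis iF : (lebesgue_rV n.+1).-integrable setT
  (fun x => (primitive0 f (u x))%:E).
Local Notation mu := (lebesgue_rV n.+1).
Local Notation density := (pohozaev_density Theta f u).
Local Notation flux := (pohozaev_flux Theta f u).
Local Notation Fu := (fun x => primitive0 f (u x)).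
Local Notation Q := (Qsign Theta).

Lemma integrable_grad_sq : mu.-integrable setT (EFin \o grad_sq u).
Proof.
have -> : EFin \o grad_sq u =
    (fun x => \sum_(j <- index_enum 'I_n.+1) (partial j u x * partial j u
      x)%:E)%E.
  by apply/funext => x /=; rewrite sumEFin.
by apply: integrable_sum => // j _; have := Lfun2_integrable_sqr (du2 j).
Qed.

Lemma integrable_QF : mu.-integrable setT (EFin \o (fun x => Q x * Fu x)).
Proof.
apply: (le_integrable measurableT _ _ iF).
  apply/measurable_EFinP; apply: measurable_funM.
    by have [] := Qsign_locally_bounded oT.
  by apply/measurable_EFinP; exact: measurable_int iF.
move=> x _ /=; rewrite lee_fin normrM /Qsign.
by case: ifP; rewrite ?normrN normr1 mul1r.
Qed.

Lemma integral_density : mu.-integrable setT (EFin \o density) /\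
  \int[mu]_x density x = (1 - n.+1%:R / 2) * (\int[mu]_x grad_sq u x) +
    n.+1%:R * (\int[mu]_x (Q x * Fu x)).
Proof.
have i1 : mu.-integrable setT (EFin \o (fun x => (1 - n.+1%:R / 2) * grad_sq u
  x)).
  exact: (integrableZl measurableT _ integrable_grad_sq).
have i2 : mu.-integrable setT (EFin \o (fun x => n.+1%:R * (Q x * Fu x))).
  exact: (integrableZl measurableT _ integrable_QF).
split; first exact: (integrableD measurableT i1 i2).
rewrite /pohozaev_density RintegralD//; congr (_ + _); rewrite RintegralZl//.
  exact: integrable_grad_sq.
exact: integrable_QF.
Qed.

Lemma grad_sq_ge0 x : 0 <= grad_sq u x.
Proof. by apply: sumr_ge0 => j _; rewrite -expr2 sqr_ge0. Qed.

Lemma partial_mul_le i j x : `|partial i u x| * `|partial j u x| <= grad_sq u x.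
Proof.
have le k : `|partial k u x| ^+ 2 <= grad_sq u x.
  rewrite real_normK ?num_real// /grad_sq (bigD1 k)//= -expr2 lerDl.
  by apply: sumr_ge0 => l _; rewrite -expr2 sqr_ge0.
have := le i; have := le j; move: (`|partial i u x|) (`|partial j u x|)
  (grad_sq u x).
move=> a b g bg ag; have := sqr_ge0 (a - b).
have -> : (a - b) ^+ 2 = a ^+ 2 - 2 * (a * b) + b ^+ 2 by ring.
lra.
Qed.

(** The growth is linear in x with an integrable factor, which is exactly what the gradient of a
    dilated cutoff compensates. The constant is n + 1 from the sum in x . grad u, plus 1 for the
    term in |grad u|^2 / 2. *)
Lemma flux_le j x : `|flux j x| <= `|x| * (n.+2%:R * grad_sq u x + `|Fu x|).
Proof.
have g0 := grad_sq_ge0 x.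
have a1 : `|radial_derivative u x * partial j u x| <= `|x| * (n.+1%:R * grad_sq
  u x).
  rewrite normrM.
  apply: (@le_trans _ _ ((\sum_i `|x| * `|partial i u x|) * `|partial j u x|)).
    apply: ler_wpM2r => //; apply: le_trans (ler_norm_sum _ _ _) _.
    by apply: ler_sum => i _; rewrite normrM ler_wpM2r// coord_le_norm.
  rewrite -mulr_sumr -mulrA ler_wpM2l// mulr_suml.
  rewrite mulr_natl -[X in _ *+ X](card_ord n.+1) -sumr_const.
  by apply: ler_sum => i _; exact: partial_mul_le.
have a2 : `|2^-1 * (grad_sq u x * x ord0 j)| <= `|x| * grad_sq u x.
  rewrite !normrM (ger0_norm g0) gtr0_norm ?invr_gt0//.
  have := coord_le_norm x j; have := normr_ge0 (x ord0 j); nra.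
have a3 : `|Q x * (primitive0 f (u x) * x ord0 j)| <= `|x| * `|primitive0 f (u
  x)|.
  rewrite !normrM /Qsign; have -> : `|if x \in Theta then 1 else -1| = 1 :> R.
    by case: ifP; rewrite ?normrN normr1.
  by rewrite mul1r mulrC ler_wpM2r// coord_le_norm.
rewrite /pohozaev_flux /stress; apply: le_trans (ler_normD _ _) _.
rewrite mulrDr lerD//; apply: le_trans (ler_normB _ _) _.
by rewrite -[n.+2]addn1 natrD mulrDl mul1r mulrDr lerD.
Qed.

Lemma scaled_flux_cvg (psi : 'rV[R]_n.+1 -> R) dpsi (r_ : nat -> R) :
  test_function psi dpsi -> (\forall x \near (0 : 'rV[R]_n.+1), psi x = 1) ->
  (forall k, 1 <= r_ k) -> r_ k @[k --> \oo] --> +oo ->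
  \int[mu]_x (psi ((r_ k)^-1 *: x) * density x +
    \sum_j ((r_ k)^-1 * dpsi j ((r_ k)^-1 *: x)) * flux j x) @[k --> \oo] -->
  \int[mu]_x density x.
Proof.
move=> hpsi psi1 r1 rr.
have r0 k : 0 < r_ k by exact: lt_le_trans (r1 k).
have [M hM] := hpsi.2.
have cpsi : continuous psi by move=> x; have [] := hpsi.1 x.
have cdpsi j : continuous (dpsi j) by move=> x; have [_ /(_ j)[]] := hpsi.1 x.
have [C C0 hC] := compactly_supported_bounded cpsi hpsi.2.
(* This bound is invariant under dilation: |x| times the gradient of psi (x / r) is |y| times that
   of psi at y = x / r. It therefore absorbs the factor |x| of the flux uniformly in r. *)
have /choice[C' hC'] : forall j, exists c : R, 0 <= c /\ forall x,
  `|x| * `|dpsi j x| <= c.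
  move=> j; have cc : continuous (fun x => `|x| * dpsi j x).
    by move=> x; apply: continuousM; [exact: norm_continuous|exact: cdpsi].
  have [|c c0 hc] := compactly_supported_bounded cc.
    by apply: compactly_supportedMr; exact: test_function_cs hpsi j.
  by exists c; split => // x; rewrite -{1}normr_id -normrM.
have [idens _] := integral_density.
pose K : R := \sum_j C' j.
pose h x := C * `|density x| + K * (n.+2%:R * grad_sq u x + `|Fu x|).
have ih : mu.-integrable setT (EFin \o h).
  have i1 : mu.-integrable setT (EFin \o (fun x => C * `|density x|)).
    exact: (integrableZl measurableT C (integrable_norm idens)).
  have i2 : mu.-integrable setT (EFin \o (fun x => n.+2%:R * grad_sq u x)).
    exact: (integrableZl measurableT _ integrable_grad_sq).
  have i3 : mu.-integrable setT (EFin \o (fun x =>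
    n.+2%:R * grad_sq u x + `|Fu x|)).
    exact: (integrableD measurableT i2 (integrable_norm iF)).
  exact: (integrableD measurableT i1 (integrableZl measurableT K i3)).
apply: (Rintegral_dominated_cvg measurableT _ _ ih _).2.
- move=> k; apply/measurable_EFinP.
  have tk := test_function_scale (r0 k) hpsi.
  by have := measurable_int _ (integrable_flux_integrand oT cf hu1 tk).
- move=> x _; apply: cvg_near_cst.
  (* [psi] is constant near 0, so at a fixed x the integrand is eventually equal to the density. *)
  have d1 j : \forall y \near (0 : 'rV[R]_n.+1), dpsi j y = 0.
    have /nbhs_ballP[e /= e0 he] := psi1.
    apply/nbhs_ballP; exists e => //= y ye.
    have [_ /(_ j)[dy _]] := hpsi.1 y.
    have near1 : \forall z \near y, psi z = (cst 1 : _ -> R) z.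
      have : nbhs y (ball (0 : 'rV[R]_n.+1) e).
        by apply: open_nbhs_nbhs; split => //; exact: ball_open.
      by apply: filterS => z /he.
    by have := near_eq_derive (basis j) near1; rewrite derive_val derive_cst.
  have d1' : \forall y \near (0 : 'rV[R]_n.+1), psi y = 1 /\ forall j,
    dpsi j y = 0.
    have FF : Filter (nbhs (0 : 'rV[R]_n.+1)) by exact: nbhs_filter.
    have d2 := filter_forall FF d1.
    exact: (filterI psi1 d2).
  have := scaled_near0 x d1' rr; apply: filterS => k [-> dk].
  by rewrite mul1r big1 ?addr0// => j _; rewrite dk mulr0 mul0r.
- move=> k x _; apply: le_trans (ler_normD _ _) _; apply: lerD.
    by rewrite normrM ler_wpM2r.
  apply: le_trans (ler_norm_sum _ _ _) _.
  rewrite mulr_suml; apply: ler_sum => j _.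
  have [c0 hc] := hC' j.
  have g0 : 0 <= n.+2%:R * grad_sq u x + `|Fu x|.
    by rewrite addr_ge0// mulr_ge0// grad_sq_ge0.
  rewrite !normrM (gtr0_norm (x := (r_ k)^-1)) ?invr_gt0//.
  apply: le_trans (ler_wpM2l _ (flux_le j x)) _;
    first by rewrite mulr_ge0// invr_ge0 ltW.
  rewrite mulrA ler_wpM2r//.
  have := hc ((r_ k)^-1 *: x); rewrite normrZ gtr0_norm ?invr_gt0//.
  by apply: le_trans; rewrite mulrAC.
Qed.

End limit.

(** * Passage to the limit in the boundary integral *)

Section surface_limit.
Context {R : realType} {n : nat}.
Variables (Theta : set 'rV[R]_n.+1) (f : R -> R) (u : 'rV[R]_n.+1 -> R).
Hypotheses (hTheta : smooth_open Theta) (cf : continuous f).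
Hypotheses (hu1 : Ck 1 setT u) (hu2 : Ck 2 Theta u) (hu2' : Ck 2 (~` closure
  Theta) u).
Hypothesis hsol : forall x, ~ boundary Theta x ->
  - laplacian u x = Qsign Theta x * f (u x).
Hypothesis du2 : forall i, partial i u \in Lfun (lebesgue_rV n.+1) 2%:E.
Hypothesis iF : (lebesgue_rV n.+1).-integrable setT
  (fun x => (primitive0 f (u x))%:E).
Variables (nu : 'rV[R]_n.+1 -> 'rV[R]_n.+1).
Hypothesis hnu : exterior_unit_normal Theta nu.
Variable sigma : {measure set 'rV[R]_n.+1 -> \bar R}.
Hypothesis hsigma : surface_measure Theta sigma.

Local Notation g := (boundary_term f u nu).
Local Notation B :=
  (2^-1 * \int[lebesgue_rV n.+1]_x pohozaev_density Theta f u x).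

(** By the flux identity the truncated surface integral is half a volume integral, whose convergence
    is known; no integrability on the boundary is used. *)
Lemma scaled_boundary_cvg phi (r_ : nat -> R) : cutoff phi ->
  (forall k, 1 <= r_ k) -> r_ k @[k --> \oo] --> +oo ->
  \int[sigma]_(z in boundary Theta) (phi ((r_ k)^-1 *: z) * g z) @[k --> \oo]
    --> B.
Proof.
move=> hphi r1 rr; have hpsi := cutoff_test hphi; have [_ phi1 _] := hphi.
have cv := scaled_flux_cvg hTheta.1 cf hu1 du2 iF hpsi phi1 r1 rr.
have E k : \int[sigma]_(z in boundary Theta) (phi ((r_ k)^-1 *: z) * g z) =
    2^-1 * \int[lebesgue_rV n.+1]_x (phi ((r_ k)^-1 *: x) *
      pohozaev_density Theta f u x +
      \sum_j ((r_ k)^-1 * partial j phi ((r_ k)^-1 *: x)) * pohozaev_flux Theta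
        f u j x).
  have r0 : 0 < r_ k by exact: lt_le_trans (r1 k).
  have tk := test_function_scale r0 hpsi.
  have [_ ->] := flux_identity_test hTheta cf hu1 hu2 hu2' hsol hnu hsigma tk.
  by rewrite mulrA mulVf// mul1r.
under eq_fun do rewrite E.
by apply: cvgM; [exact: cvg_cst|exact: cv].
Qed.

Lemma boundary_integral_pohozaev : boundary_integral Theta sigma g B.
Proof.
split=> [ig|phi hphi].
  have mb := boundary_measurable Theta.
  have [phi hphi] := @exists_cutoff R n.+1.
  have hpsi := cutoff_test hphi; have [_ phi1 _] := hphi.
  have cphi : continuous phi by move=> x; have [] := hpsi.1 x.
  have [C C0 hC] := compactly_supported_bounded cphi hpsi.2.
  pose r_ (k : nat) : R := k.+1%:R.
  have r1 k : 1 <= r_ k by rewrite /r_ ler1n.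
  have rr : r_ k @[k --> \oo] --> +oo.
    apply/cvgryPge => A; near=> k; rewrite /r_.
    apply: (@le_trans _ _ k%:R); last by rewrite ler_nat.
    by near: k; exact: nbhs_infty_ger.
  have iCg : sigma.-integrable (boundary Theta) (EFin \o (fun z => C * `|g z|)).
    exact: (integrableZl mb C (integrable_norm ig)).
  (* When [g] is integrable, the truncated integrals also converge to its Lebesgue integral, which
     must then equal B by uniqueness of limits. *)
  have [|||_ cv] := @Rintegral_dominated_cvg _ _ _ sigma (boundary Theta)
      (fun k z => phi ((r_ k)^-1 *: z) * g z) g (fun z =>
        C * `|g z|) mb _ _ iCg _.
  - move=> k; apply: measurable_funM.
      have cs : continuous (fun x : 'rV[R]_n.+1 => (r_ k)^-1 *: x).
        exact: scaler_continuous.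
      have cpk : continuous (fun x : 'rV[R]_n.+1 => phi ((r_ k)^-1 *: x)).
        by move=> x; exact: (continuous_comp (@cs x) (@cphi _)).
      exact: continuous_measurable_fun_rV cpk.
    by apply/measurable_EFinP; exact: measurable_int ig.
  - move=> z _; apply: cvg_near_cst.
    by have := scaled_near0 z phi1 rr; apply: filterS => k ->; rewrite mul1r.
  - by move=> k z _; rewrite normrM ler_wpM2r.
  by move/cvg_lim : cv => <-//; apply/esym/cvg_lim => //;
    exact: scaled_boundary_cvg.
(* Convergence at infinity is tested along arbitrary sequences, whose first terms may be below 1;
   replacing r by max (r, 1) changes nothing for large r. *)
pose S r := \int[sigma]_(z in boundary Theta) (phi (r^-1 *: z) * g z).
have SB : S (Num.max r 1) @[r --> +oo] --> B.
  apply/cvg_pinftyP => s_ ss; apply: (scaled_boundary_cvg (r_ := fun k =>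
    Num.max (s_ k) 1)) => //.
    by move=> k; rewrite le_max lexx orbT.
  apply/cvgryPge => A; have /cvgryPge/(_ A) := ss; apply: filterS => k Ak.
  by rewrite le_max Ak.
apply: cvg_trans SB; apply: near_eq_cvg; near=> r; rewrite /S max_l//.
Unshelve. all: by end_near. Qed.

End surface_limit.

Theorem theorem3p1 (R : realType) (N : nat) (hN : (3 <= N)%N)
  (Theta : set 'rV[R]_N) (hTheta : smooth_open Theta)
  (nu : 'rV[R]_N -> 'rV[R]_N) (hnu : exterior_unit_normal Theta nu)
  (sigma : {measure set 'rV[R]_N -> \bar R}) (hsigma : surface_measure Theta sigma)
  (f : R -> R) (hf : continuous f)
  (u : 'rV[R]_N -> R)
  (hu1 : Ck 1 setT u) (hu2 : Ck 2 Theta u) (hu2' : Ck 2 (~` closure Theta) u)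
  (huD : D12_C1 u)
  (hsol : forall x, ~ boundary Theta x ->
     - laplacian u x = Qsign Theta x * f (u x))
  (hF : (lebesgue_rV N).-integrable setT (fun x => (primitive0 f (u x))%:E)) :
  exists2 B : R,
    boundary_integral Theta sigma
      (fun z => primitive0 f (u z) * dotp z (nu z)) B &
    (sobolev_exponent N)^-1 * (\int[lebesgue_rV N]_x enorm (grad u x) ^+ 2)
    - \int[lebesgue_rV N]_x (Qsign Theta x * primitive0 f (u x))
    + 2 / N%:R * B = 0.
Proof.
case: N hN Theta hTheta nu hnu sigma hsigma u hu1 hu2 hu2' huD hsol hF =>
  [//|n] hN.
move=> Theta hTheta nu hnu sigma hsigma u hu1 hu2 hu2' [_ du2] hsol hF.
(* The factor 1/2 undoes the jump 2 of Q in the flux identity. *)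
exists (2^-1 * \int[lebesgue_rV n.+1]_x pohozaev_density Theta f u x).
  exact: boundary_integral_pohozaev.
have [_ ->] := integral_density hTheta.1 du2 hF.
have -> : (fun x => enorm (grad u x) ^+ 2) = grad_sq u.
  apply/funext => x; rewrite sqr_sqrtr /dotp.
    by apply: eq_bigr => j _; rewrite !mxE.
  by apply: sumr_ge0 => j _; rewrite -expr2 sqr_ge0.
rewrite /sobolev_exponent.
(* What remains is algebra in the two integrals: (2 / N) B is 1 / N times the integral of the
   density, and (1 - N/2) / N = - (N - 2) / (2 N). *)
have N0 : n.+1%:R != 0 :> R by [].
have N2 : n.+1%:R - 2 != 0 :> R by rewrite subr_eq0 eqr_nat gtn_eqF.
move: (n.+1%:R : R) N0 N2 => N N0 N2; field.
by rewrite N0 N2.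
Qed.
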